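(* Let $k$ be a field of characteristic zero, let $f,g\in k[x]$ be nonconstant, and put $m=\deg f$, $n=\deg g$, $e=\gcd(m,n)$, $M=m/e$, $N=n/e$. Every geometrically integral component $C$ of $C_{f,g}=(f(X)-g(Y)=0)_{\mathrm{red}}\subset\mathbb A^2_k$ satisfies $$d_X(C)=N\,\#D_C,\qquad d_Y(C)=M\,\#D_C.$$ In particular, every log-negative component has $$d_X(C)=N,\qquad d_Y(C)=M.$$ If such a log-negative component is non-graph, then $N\ge 2$. Equivalently, the set of values $d_X(C)$, for $C$ ranging over the non-graph log-negative components of $C_{f,g}$, is either empty or equal to $\{N\}$ when $N\ge2$, and is empty when $N=1$.
   Context: For a geometrically integral component $C$ of $C_{f,g}$: $C^\nu$ is its affine normalization, $\widetilde C$ its smooth projective normalization, and $D_C=\widetilde C\setminus C^\nu$ the boundary, with $\#D_C$ the number of geometric boundary points. $d_X(C)=\deg(X:\widetilde C\to\mathbb P^1)$ and $d_Y(C)=\deg(Y:\widetilde C\to\mathbb P^1)$. The logarithmic degree is $\lambda(C)=2\,\mathrm{genus}(\widetilde C)-2+\#D_C$; $C$ is log-negative if $\lambda(C)<0$, equivalently $\mathrm{genus}(\widetilde C)=0$ and $\#D_C=1$ (''one-infinity''). A graph component is a component of the form $Y=h(X)$ with $h\in k[X]$ and $f=g\circ h$; other components are non-graph. *)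

(* Defs.v *)
From HB Require Import structures.
From mathcomp Require Import all_boot all_order all_algebra.
From mathcomp Require Import ring_quotient generic_quotient fraction finmap.
From mathcomp Require Import boolp classical_sets functions cardinality fsbigop.

Set Implicit Arguments.
Unset Strict Implicit.
Unset Printing Implicit Defensive.

Import GRing.Theory Num.Theory.
Local Open Scope ring_scope.
Local Open Scope quotient_scope.
Local Open Scope classical_set_scope.

Section PrimeQuotient.
Variables (R : comNzRingType) (I : prime_idealr R).

Definition prime_quot : Type := {ideal_quot I}.
HB.instance Definition _ := GRing.ComNzRing.on prime_quot.

Definition prime_quot_unit : {pred prime_quot} :=
  fun x => `[< exists y, y * x = 1 >].
Definition prime_quot_inv (x : prime_quot) : prime_quot :=
  xget x [set y | y * x = 1].

Lemma prime_quot_mulVx :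
  {in prime_quot_unit, left_inverse 1 prime_quot_inv *%R}.
Proof.
move=> x /asboolP hx; rewrite /prime_quot_inv.
by case: xgetP => [y -> //|nx]; case: hx => y /nx.
Qed.

Lemma prime_quot_unitP (x y : prime_quot) : y * x = 1 -> prime_quot_unit x.
Proof. by move=> h; apply/asboolP; exists y. Qed.

Lemma prime_quot_inv_out :
  {in [predC prime_quot_unit], prime_quot_inv =1 id}.
Proof.
move=> x /negP hx; rewrite /prime_quot_inv.
by case: xgetP => [y -> /prime_quot_unitP /hx|//].
Qed.

HB.instance Definition _ := GRing.ComNzRing_hasMulInverse.Build prime_quot
  prime_quot_mulVx prime_quot_unitP prime_quot_inv_out.

Lemma prime_quot_idomain : GRing.integral_domain_axiom prime_quot.
Proof. by move=> x y; move=> h; apply: Quotient.rquot_IdomainAxiom. Qed.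

HB.instance Definition _ :=
  GRing.ComUnitRing_isIntegral.Build prime_quot prime_quot_idomain.

Definition prime_class (a : R) : prime_quot := \pi_({ideal_quot I}) a.

Lemma prime_class_zmod_morphism : zmod_morphism prime_class.
Proof. exact: pi_is_zmod_morphism. Qed.

Lemma prime_class_monoid_morphism : monoid_morphism prime_class.
Proof. exact: pi_is_monoid_morphism. Qed.

HB.instance Definition _ := GRing.isZmodMorphism.Build R prime_quot
  prime_class prime_class_zmod_morphism.
HB.instance Definition _ := GRing.isMonoidMorphism.Build R prime_quot
  prime_class prime_class_monoid_morphism.
End PrimeQuotient.

(* [k[X,Y]] is [{poly {poly k}}]: the inner variable ['X%:P] is X and the
   outer variable ['X] is Y. *)
Definition curve_eqn (k : fieldType) (f g : {poly k}) : {poly {poly k}} :=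
  f%:P - map_poly polyC g.

(* True divisibility: on [{poly {poly k}}] the library's [%|] is
   pseudo-divisibility, which ignores factors in [k[X]]. *)
Definition divides (R : comNzRingType) (a b : R) : Prop := exists c, b = c * a.

Definition prime_element (R : idomainType) (p : R) : Prop :=
  [/\ p != 0, p \isn't a GRing.unit &
      forall a b : R, divides p (a * b) -> divides p a \/ divides p b].

(* The integral affine plane curve [Spec k[X,Y]/(P)]. *)
Record plane_curve (k : fieldType) := PlaneCurve {
  equation : {poly {poly k}};
  equation_prime : prime_element equation
}.

Definition curve_ideal (k : fieldType) (C : plane_curve k) :
    {poly {poly k}} -> bool :=
  fun A => `[< divides (equation C) A >].

Section CurveIdeal.
Variables (k : fieldType) (C : plane_curve k).

Lemma curve_ideal_closed : idealr_closed (curve_ideal C).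
Proof.
case: (equation_prime C) => _ nu _; split.
- by apply/asboolP; exists 0; rewrite mul0r.
- apply/negP => /asboolP [B hB]; move/negP: nu; apply.
  by apply/unitrP; exists B; rewrite [equation C * B]mulrC -hB.
- move=> a u v /asboolP [B ->] /asboolP [B' ->]; apply/asboolP.
  by exists (a * B + B'); rewrite mulrDl mulrA.
Qed.

HB.instance Definition _ :=
  isIdealr.Build {poly {poly k}} (curve_ideal C) curve_ideal_closed.

Lemma curve_ideal_prime : prime_idealr_closed (curve_ideal C).
Proof.
move=> u v /asboolP huv; case: (equation_prime C) => _ _ /(_ u v huv).
by case=> h; apply/orP; [left|right]; apply/asboolP.
Qed.

HB.instance Definition _ :=
  isPrimeIdealrClosed.Build {poly {poly k}} (curve_ideal C) curve_ideal_prime.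
End CurveIdeal.

Section PlaneCurve.
Variables (k : fieldType) (C : plane_curve k).

Definition curve_prime_ideal : prime_idealr {poly {poly k}} :=
  PrimeIdealr.clone _ (curve_ideal C) _.

Definition coordinate_ring : idomainType := prime_quot curve_prime_ideal.

Definition function_field : fieldType := {fraction coordinate_ring}.

Definition coord_fun (A : {poly {poly k}}) : function_field :=
  tofrac (prime_class curve_prime_ideal A : coordinate_ring).

Definition const_fun (c : k) : function_field := coord_fun c%:P%:P.
Definition fun_X : function_field := coord_fun 'X%:P.
Definition fun_Y : function_field := coord_fun 'X.
End PlaneCurve.

(* For a subfield [F] of [K] and [F]-subspaces [W], [V] of [K] with
   [W `<=` V], [has_dim F V W n] says that [V / W] has [F]-dimension [n]. *)
Definition has_dim (K : fieldType) (F V W : set K) (n : nat) : Prop :=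
  exists b : 'I_n -> K,
    [/\ forall i, V (b i),
        forall z, V z -> exists c : 'I_n -> K,
          (forall i, F (c i)) /\ W (z - \sum_(i < n) c i * b i)
      & forall c : 'I_n -> K, (forall i, F (c i)) ->
          W (\sum_(i < n) c i * b i) -> forall i, c i = 0].

(* 0 if the dimension is infinite. *)
Definition qdim (K : fieldType) (F V W : set K) : nat :=
  xget 0%N [set n | has_dim F V W n].

Section SmoothModel.
Variables (k : fieldType) (C : plane_curve k).
Local Notation K := (function_field C).

Definition const_field : set K := range (const_fun C).

(* The closed points of the smooth projective model of [C] are the valuation
   rings [O] of [k(C)/k] with [k < O < k(C)]. *)
Definition place (O : set K) : Prop :=
  [/\ const_field `<=` O,
      (forall u v, O u -> O v -> O (u - v) /\ O (u * v)),
      (forall z, z != 0 -> O z \/ O z^-1)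
    & O != setT].

Definition maximal_ideal (O : set K) : set K :=
  [set z | O z /\ (z = 0 \/ ~ O z^-1)].

Definition uniformizer (O : set K) (t : K) : Prop :=
  t != 0 /\ maximal_ideal O = [set t * u | u in O].

Definition place_degree (O : set K) : nat :=
  qdim const_field O (maximal_ideal O).

(* The coordinate ring of the affine normalization of [C]. *)
Definition normalization : set K :=
  [set z | integralOver (fun a : coordinate_ring C => tofrac a : K) z].

(* The points at infinity: those which do not lie on the affine
   normalization, i.e. where some regular function of it has a pole. *)
Definition boundary : set (set K) :=
  [set O | place O /\ ~ (normalization `<=` O)].

Definition simple_subfield (t : K) : set K :=
  [set z | exists p q : {poly k},
     (map_poly (const_fun C) q).[t] != 0 /\
     z = (map_poly (const_fun C) p).[t] /
         (map_poly (const_fun C) q).[t]].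

(* The degree [[k(C) : k(t)]] of the map to the projective line given by
   [t]; it is 0 for constant [t]. *)
Definition map_degree (t : K) : nat :=
  qdim (simple_subfield t) setT [set 0].

Definition divisor (D : set K -> int) : Prop :=
  finite_set [set O | place O /\ D O != 0].

Definition divisor_degree (D : set K -> int) : int :=
  \sum_(O \in place) D O * (place_degree O)%:Z.

(* The functions [z] with [v_O(z) >= - D O] at every place [O]. *)
Definition riemann_roch_space (D : set K -> int) : set K :=
  [set z | forall O t, place O -> uniformizer O t -> O (z * t ^ D O)].

Definition ell (D : set K -> int) : nat :=
  qdim const_field (riemann_roch_space D) [set 0].

(* The genus is the maximum of [deg D + 1 - ell D] over all divisors. *)
Definition is_genus (g : nat) : Prop :=
  (forall D, divisor D -> divisor_degree D + 1 - (ell D)%:Z <= g%:Z) /\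
  (exists2 D, divisor D & divisor_degree D + 1 - (ell D)%:Z = g%:Z).

Definition genus : nat := xget 0%N is_genus.
End SmoothModel.

Section GeometricallyIntegral.
Variables (k : fieldType) (kbar : closedFieldType).
Variable iota : {rmorphism k -> kbar}.

(* With [kbar] an algebraic closure of [k]. *)
Record geom_integral_curve := GeomIntegralCurve {
  geom_curve :> plane_curve k;
  geom_prime : prime_element (map_poly (map_poly iota) (equation geom_curve))
}.

Variable C : geom_integral_curve.

Definition base_change : plane_curve kbar := PlaneCurve (geom_prime C).

Definition nb_boundary : nat := #|` fset_set (@boundary _ base_change)|.

Definition d_X : nat := map_degree (fun_X C).
Definition d_Y : nat := map_degree (fun_Y C).

Definition log_degree : int := 2%:Z * (genus C)%:Z - 2%:Z + nb_boundary%:Z.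

Definition log_negative : Prop := log_degree < 0.

(* The irreducible components of the plane curve [f(X) = g(Y)] are the curves
   cut out by the prime divisors of its equation. *)
Definition component_of (f g : {poly k}) : Prop :=
  divides (equation C) (curve_eqn f g).

(* [C] is the curve [Y = h(X)], with [f = g o h]. *)
Definition graph_component (f g : {poly k}) : Prop :=
  exists h : {poly k}, f = g \Po h /\
    forall A, divides (equation C) A <-> divides ('X - h%:P) A.
End GeometricallyIntegral.

(* Main.v *)
(* Let [P] be the equation of the component over the algebraic closure, [x] and
   [y] the coordinate functions, and choose [b M = a N + 1].  In the toric chart
   with coordinates [t = x^a / y^b] and [u = y^N / x^M] one has
   [1/x = t^N u^b] and [1/y = t^M u^a], and the curve meets [t = 0] only where
   [u^e] is the quotient of the leading coefficients of [f] and [g].  In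
   characteristic 0 this equation has simple roots, so at each such point [w]
   the curve is smooth with uniformizer [t]: the local ring there is a valuation
   ring, it is the only place centred at [w], and every place at infinity
   arises this way.  On the other hand, the top-weight part of [P] for the
   weights [N] of [X] and [M] of [Y] divides that of [f(X) - g(Y)], hence,
   dehomogenized at [X = 1], is separable of degree [deg_Y P]; its roots are the
   [N]-th roots of the points [w].  So [d_X = deg_Y P = N #D], and [d_Y] follows
   by exchanging [X] and [Y].  The genus never enters: [#D > 0] already forces
   [#D = 1] on log-negative components. *)
Require Import Defs.
From HB Require Import structures.
From mathcomp Require Import all_boot all_order all_algebra all_field.
From mathcomp Require Import polyXY fraction finmap ring zify.
From mathcomp Require Import boolp classical_sets functions cardinality.

Set Implicit Arguments.
Unset Strict Implicit.
Unset Printing Implicit Defensive.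

Import GRing.Theory.
Local Open Scope ring_scope.
Local Open Scope classical_set_scope.

(** * The degree of the function field over a coordinate *)

Lemma divides_size (R : idomainType) (P A : {poly R}) :
  divides P A -> A != 0 -> (size P <= size A)%N.
Proof.
case=> B ->; rewrite mulf_eq0 negb_or => /andP[B0 P0].
rewrite size_mul // -(prednK (n := size B)) ?size_poly_gt0 //.
by rewrite addSn leq_addl.
Qed.

(** The resultant of [P] and [A] lies in their ideal. If it vanished, they would share a factor [D]
    of positive degree, with [P] dividing [E * D] up to a constant. By primality and degree, [P]
    would divide [D], hence a constant multiple of [A], hence [A]. *)
Lemma prime_element_elimination (R : idomainType) (P A : {poly R}) :
    prime_element P -> (1 < size P)%N -> ~ divides P A ->
  exists U V : {poly R}, exists2 r, r != 0 & U * A + V * P = r%:P.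
Proof.
move=> [P0 _ Pprime] sP PA.
have cst (c : R) : c != 0 -> ~ divides P c%:P.
  move=> c0 /divides_size; rewrite polyC_eq0 => /(_ c0).
  by move/leq_trans/(_ (size_polyC_leq1 c)); rewrite leqNgt sP.
case: (leqP (size A) 1) => [/size1_polyC A1|sA].
  exists 1, 0, A`_0; last by rewrite mul1r mul0r addr0.
  apply/eqP => a0; apply: PA; exists 0.
  by rewrite A1 a0 mul0r.
have [[u v] _ /= uv] := resultant_in_ideal sP sA.
exists v, u, (resultant P A); last by rewrite addrC uv.
rewrite resultant_eq0 -leqNgt leqNgt; apply/negP => sD.
(* Over a domain [gcdp] divides only up to the nonzero scalars [c] and [c']. *)
have /Pdiv.Idomain.dvdpP[[c E] /= c0 cE] := dvdp_gcdl P A.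
have /Pdiv.Idomain.dvdpP[[c' E'] /= c0' cE'] := dvdp_gcdr P A.
set D := gcdp P A in sD cE cE'.
have E0 : E != 0.
  apply: contra_neq P0 => E0; apply/eqP.
  by move/eqP: cE; rewrite E0 mul0r -mul_polyC mulf_eq0 polyC_eq0 (negPf c0).
have D0 : D != 0 by rewrite -size_poly_gt0 (ltn_trans _ sD).
have : divides P (E * D) by exists c%:P; rewrite mul_polyC.
case/Pprime => [/divides_size/(_ E0)|[B DB]].
  have := congr1 (fun p : {poly R} => size p) cE; rewrite size_scale // size_mul // => ->.
  move: sD; rewrite -size_poly_gt0 in E0; move: E0; clear.
  by move: (size E) (size D) => e d; lia.
have : divides P (c'%:P * A).
  by exists (E' * B); rewrite mul_polyC cE' DB mulrA.
by case/Pprime => // /(cst _ c0').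
Qed.

(** * Dimension over a subfield *)

Definition subfield_set (K : fieldType) (F : set K) : Prop :=
  [/\ F 1, (forall u v, F u -> F v -> F (u - v)),
      (forall u v, F u -> F v -> F (u * v)) & forall u, F u -> F u^-1].

Section SubfieldDimension.
Variables (K : fieldType) (F : set K).
Hypothesis F_subfield : subfield_set F.

Lemma subfield_set0 : F 0.
Proof. by case: F_subfield => F1 FB _ _; rewrite -(subrr 1); apply: FB. Qed.

Lemma subfield_setN u : F u -> F (- u).
Proof.
case: F_subfield => _ FB _ _ Fu.
by rewrite -sub0r; apply: FB => //; exact: subfield_set0.
Qed.

Lemma subfield_set_sum (I : Type) (s : seq I) (P : pred I) (c : I -> K) :
  (forall i, P i -> F (c i)) -> F (\sum_(i <- s | P i) c i).
Proof.
case: F_subfield => _ FB _ _ Fc; elim/big_ind: _ => //.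
  exact: subfield_set0.
by move=> u v Fu Fv; rewrite -(opprK v); apply/FB/subfield_setN.
Qed.

(** Gaussian elimination, by induction on the number of columns: a row [i0] with nonzero first entry
    clears the first column of the other rows, and its own coefficient is fixed last. *)
Lemma subfield_dependence n m (A : 'I_m -> 'I_n -> K) :
    (n < m)%N -> (forall i j, F (A i j)) ->
  exists c : 'I_m -> K, [/\ forall i, F (c i), exists i, c i != 0 &
    forall j, \sum_i c i * A i j = 0].
Proof.
case: F_subfield => F1 FB FM FV.
elim: n m A => [|n IHn] [//|m] A ltnm FA.
  exists (fun=> 1); split=> [i||j]; [by []| |by case: j].
  by exists ord0; exact: oner_neq0.
case: (pselect (exists i0, A i0 ord0 != 0)) => [[i0 Ai0]|noA]; last first.
  have [c [Fc c0 cA]] := IHn _ (fun i j => A i (lift ord0 j)) (ltnW ltnm)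
    (fun i j => FA i _).
  exists c; split=> // j; case: (unliftP ord0 j) => [j'|] -> //.
  rewrite big1 // => i _; case: (eqVneq (A i ord0) 0) => [->|Ai].
    by rewrite mulr0.
  by case: noA; exists i.
pose q i := A (lift i0 i) ord0 / A i0 ord0.
have Fq i : F (q i) by apply: FM => //; apply: FV.
have [|c [Fc [i1 c0] cA]] := IHn m
  (fun i j => A (lift i0 i) (lift ord0 j) - q i * A i0 (lift ord0 j)) ltnm.
  by move=> i j; apply: FB => //; apply: FM.
pose d i := if unlift i0 i is Some i' then c i' else - \sum_i c i * q i.
have dl i : d (lift i0 i) = c i by rewrite /d liftK.
have d0 : d i0 = - \sum_i c i * q i by rewrite /d unlift_none.
exists d; split.
- move=> i; rewrite /d; case: unliftP => [i' _|_] //.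
  by apply/subfield_setN/subfield_set_sum => i' _; apply: FM.
- by exists (lift i0 i1); rewrite dl.
move=> j; rewrite (bigD1_ord i0) //= d0 mulNr mulr_suml.
case: (unliftP ord0 j) => [j'|] ->.
  rewrite addrC; apply: etrans (cA j'); rewrite -sumrB.
  by apply: eq_bigr => i _; rewrite dl; ring.
rewrite addrC -sumrB big1 // => i _.
by rewrite dl /q -mulrA mulfVK // subrr.
Qed.

(** A family longer than a basis is dependent over [F]. Used in both directions, this makes the
    number selected in [qdim] unique. *)
Lemma has_dim_le (n m : nat) :
  has_dim F setT [set 0] n -> has_dim F setT [set 0] m -> (m <= n)%N.
Proof.
move=> [b [_ span_b _]] [b' [_ _ free_b']].
rewrite leqNgt; apply/negP => ltnm.
have /choice[A HA] : forall i : 'I_m, exists c : 'I_n -> K, (forall j, F (c j)) /\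
    b' i = \sum_j c j * b j.
  move=> i; have [c [Fc]] := span_b (b' i) I.
  by move/eqP; rewrite subr_eq0 => /eqP ?; exists c.
have [c [Fc [i0 ci0] cA]] := subfield_dependence ltnm (fun i => (HA i).1).
move/eqP: ci0; apply; apply: free_b' => //=.
under eq_bigr => i _ do rewrite (HA i).2 mulr_sumr.
rewrite exchange_big big1 //= => j _.
under eq_bigr => i _ do rewrite mulrA.
by rewrite -mulr_suml cA mul0r.
Qed.

Lemma qdim_eq n : has_dim F setT [set 0] n -> qdim F setT [set 0] = n.
Proof.
rewrite /qdim => dimn; case: xgetP => [m _ dimm|/(_ n)/(_ dimn)//].
by apply/eqP; rewrite eqn_leq !has_dim_le.
Qed.
End SubfieldDimension.

(** [phi] presents [K] as the fraction field of R/(P). Keeping [K] abstract lets the same field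
    serve a curve and its image under the exchange of coordinates. *)
Definition function_field_of (R : idomainType) (K : fieldType)
    (phi : {rmorphism R -> K}) (P : R) : Prop :=
  (forall A, phi A = 0 <-> divides P A) /\
  (forall z, exists A B, phi B != 0 /\ z = phi A / phi B).

(** * The function field as an extension of k(x) *)

Section FieldDegree.
Variables (k K : fieldType) (phi : {rmorphism {poly {poly k}} -> K}).
Variable P : {poly {poly k}}.
Hypothesis phiP : function_field_of phi P.
Hypothesis P_prime : prime_element P.
Hypothesis sP : (1 < size P)%N.

Lemma function_field_polyC_eq0 (r : {poly k}) : (phi r%:P == 0) = (r == 0).
Proof.
apply/eqP/eqP => [/phiP.1/divides_size Pr|->]; last by rewrite rmorph0.
apply: contraTeq sP => r0; rewrite -leqNgt.
by apply: leq_trans (Pr _) (size_polyC_leq1 _); rewrite polyC_eq0.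
Qed.

(** Elimination gives [U * B] congruent modulo [P] to a nonzero [r] in k[X], so A/B = AU/r in
    [K]. *)
Lemma function_field_denominator (z : K) :
  exists U r, r != 0 /\ z = phi U / phi r%:P.
Proof.
have [A [B [B0 ->]]] := phiP.2 z.
have nPB : ~ divides P B by move/phiP.1/eqP; rewrite (negPf B0).
have [U [V [r r0 Er]]] := prime_element_elimination P_prime sP nPB.
exists (A * U), r; split=> //.
have phiP0 : phi P = 0 by apply/phiP.1; exists 1; rewrite mul1r.
have Er' : phi U * phi B = phi r%:P.
  by rewrite -Er rmorphD !rmorphM /= phiP0 mulr0 addr0.
have r0' : phi r%:P != 0 by rewrite function_field_polyC_eq0.
rewrite rmorphM /=; apply/eqP; rewrite eqr_div // -Er'; apply/eqP; ring.
Qed.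

Definition rational_subfield : set K :=
  [set z | exists p q : {poly k}, phi q%:P != 0 /\ z = phi p%:P / phi q%:P].

Lemma rational_subfieldP : subfield_set rational_subfield.
Proof.
split.
- by exists 1, 1; rewrite rmorph1 oner_neq0 divr1.
- move=> _ _ [p [q [q0 ->]]] [p' [q' [q'0 ->]]].
  exists (p * q' - p' * q), (q * q').
  rewrite polyCB !polyCM rmorphB !rmorphM /= mulf_neq0 //; split=> //.
  by field; rewrite ?q0 ?q'0.
- move=> _ _ [p [q [q0 ->]]] [p' [q' [q'0 ->]]].
  exists (p * p'), (q * q').
  rewrite !polyCM !rmorphM /= mulf_neq0 //; split=> //.
  by field; rewrite ?q0 ?q'0.
move=> _ [p [q [q0 ->]]]; case: (eqVneq (phi p%:P) 0) => [->|p0].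
  by exists 0, 1; rewrite rmorph1 oner_neq0 mul0r invr0 !rmorph0 mul0r.
by exists q, p; rewrite p0 invf_div.
Qed.

Hypothesis lP : lead_coef P \is a GRing.unit.

(** The powers of y below the degree of [P] in Y form a basis. They span by division by [P], which
    is available because its leading coefficient is a unit. They are free because a relation with
    cleared denominators is a multiple of [P] of smaller degree. *)
Lemma function_field_degree :
  qdim rational_subfield setT [set 0] = (size P).-1.
Proof.
apply: (qdim_eq rational_subfieldP).
have sP1 : (size P).-1.+1 = size P by rewrite prednK // (ltn_trans _ sP).
exists (fun i => phi 'X ^+ i); split=> [//|z _|c Fc /= c0].
  have [U [r [r0 ->]]] := function_field_denominator z.
  have r0' : phi r%:P != 0 by rewrite function_field_polyC_eq0.
  pose S := U %% P; exists (fun i => phi (S`_i)%:P / phi r%:P).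
  split=> [i|]; first by exists S`_i, r.
  have phiP0 : phi P = 0 by apply/phiP.1; exists 1; rewrite mul1r.
  rewrite (Pdiv.IdomainUnit.divp_eq lP U) -/S rmorphD rmorphM /= phiP0.
  rewrite mulr0 add0r /=; apply/eqP; rewrite subr_eq0; apply/eqP.
  have sS : (size S <= (size P).-1)%N.
    by rewrite -ltnS sP1 Pdiv.Idomain.ltn_modpN0 // -size_poly_gt0 (ltn_trans _ sP).
  have {1}-> : S = \poly_(i < (size P).-1) S`_i.
    apply/polyP => i; rewrite coef_poly; case: ltnP => // Hi.
    by rewrite nth_default // (leq_trans sS Hi).
  rewrite poly_def rmorph_sum mulr_suml; apply: eq_bigr => i _.
  by rewrite -mul_polyC rmorphM rmorphXn /= mulrAC.
have /choice[p /choice[q Hpq]] := Fc.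
(* [Q i] is the product of the other denominators, so [A] is the given relation multiplied by all of
   them. *)
pose Q i := \prod_(j | j != i) q j.
have q0 j : q j != 0 by rewrite -function_field_polyC_eq0 (Hpq j).1.
pose A := \poly_(i < (size P).-1)
  (if insub i is Some j then p j * Q j else 0).
have A0 : A = 0.
  have [//|A0] := eqVneq A 0.
  have /divides_size/(_ A0) : divides P A.
    apply/phiP.1; rewrite /A poly_def rmorph_sum.
    transitivity (\sum_i (\prod_j phi (q j)%:P) * (c i * phi 'X ^+ i)); last first.
      by rewrite -mulr_sumr c0 mulr0.
    apply: eq_bigr => i _; rewrite valK -mul_polyC !rmorphM rmorphXn /=.
    rewrite (bigD1 i) //= [in RHS](Hpq i).2 /Q !rmorph_prod /=.
    by field; exact: (Hpq i).1.
  by rewrite leqNgt -sP1 ltnS size_poly.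
move=> i; have := coef_poly (size P).-1
  (fun i => if insub i is Some j then p j * Q j else 0) i.
rewrite -/A A0 coef0 ltn_ord valK => /esym/eqP.
rewrite mulf_eq0 => /orP[/eqP pi0|]; first by rewrite (Hpq i).2 pi0 rmorph0 mul0r.
by rewrite prodf_seq_eq0 => /hasP[j _ /andP[_]]; rewrite (negPf (q0 j)).
Qed.
End FieldDegree.

(** * Evaluation in two variables and expansion at infinity *)

Section EvalXY.
Variables (L : fieldType) (S : comNzRingType) (j : {rmorphism L -> S}).

Definition eval_poly (s : S) : {poly L} -> S :=
  horner_morph (fun c => mulrC s (j c)).
HB.instance Definition _ s := GRing.RMorphism.on (eval_poly s).

Definition evalXY (s z : S) : {poly {poly L}} -> S :=
  horner_morph (fun p => mulrC z (eval_poly s p)).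
HB.instance Definition _ s z := GRing.RMorphism.on (evalXY s z).

Lemma eval_polyC s c : eval_poly s c%:P = j c.
Proof. exact: horner_morphC. Qed.

Lemma eval_polyX s : eval_poly s 'X = s.
Proof. exact: horner_morphX. Qed.

Lemma evalXY_polyC s z p : evalXY s z p%:P = eval_poly s p.
Proof. exact: horner_morphC. Qed.

Lemma evalXY_Y s z : evalXY s z 'X = z.
Proof. exact: horner_morphX. Qed.

Lemma evalXYB s z A B : evalXY s z (A - B) = evalXY s z A - evalXY s z B.
Proof. by rewrite rmorphD rmorphN. Qed.

Lemma evalXYM s z A B : evalXY s z (A * B) = evalXY s z A * evalXY s z B.
Proof. by rewrite rmorphM. Qed.

Lemma eval_polyB s p q : eval_poly s (p - q) = eval_poly s p - eval_poly s q.
Proof. by rewrite rmorphD rmorphN. Qed.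

Lemma evalXY_map_polyC s z p : evalXY s z (map_poly polyC p) = eval_poly z p.
Proof.
elim/poly_ind: p => [|p c IHp]; first by rewrite !rmorph0.
rewrite !(rmorphD, rmorphM) /= map_polyX map_polyC /= IHp evalXY_Y evalXY_polyC.
by rewrite !eval_polyC eval_polyX.
Qed.
End EvalXY.

Section RmorphEvalXY.
Variables (L : fieldType) (S : comNzRingType).
Variable phi : {rmorphism {poly {poly L}} -> S}.

Definition const_morph : {rmorphism L -> S} := phi \o polyC \o polyC.

Lemma rmorph_polyCE p : phi p%:P = eval_poly const_morph (phi 'X%:P) p.
Proof.
elim/poly_ind: p => [|p c IHp]; first by rewrite !rmorph0.
by rewrite !(rmorphD, rmorphM) /= IHp eval_polyC eval_polyX.
Qed.

Lemma rmorph_evalXY A : phi A = evalXY const_morph (phi 'X%:P) (phi 'X) A.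
Proof.
elim/poly_ind: A => [|A p IHA]; first by rewrite !rmorph0.
by rewrite !(rmorphD, rmorphM) /= IHA rmorph_polyCE evalXY_polyC evalXY_Y.
Qed.
End RmorphEvalXY.

(** [q] carries the lower coefficients of [p] in reverse order; it depends on neither [K], [j] nor
    [z]. *)
Lemma poly_at_infinity (L : fieldType) (p : {poly L}) : p != 0 ->
  exists q : {poly L}, forall (K : fieldType) (j : {rmorphism L -> K}) (z : K),
    z != 0 -> eval_poly j z p =
      z ^+ (size p).-1 * (j (lead_coef p) + z^-1 * eval_poly j z^-1 q).
Proof.
elim/poly_ind: p => [/eqP//|p c IHp]; case: (eqVneq p 0) => [->|p0 _].
  rewrite mul0r add0r polyC_eq0 => c0; exists 0 => K j z z0.
  by rewrite size_polyC c0 lead_coefC eval_polyC rmorph0 mulr0 addr0 mul1r.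
have [q Hq] := IHp p0; exists (q + c%:P * 'X ^+ (size p).-1) => K j z z0.
have sp : (size p).-1.+1 = size p by rewrite prednK // size_poly_gt0.
have -> : lead_coef (p * 'X + c%:P) = lead_coef p.
  by rewrite lead_coefDl ?lead_coefMX // size_mulX //
    (leq_ltn_trans (size_polyC_leq1 _)) // ltnS size_poly_gt0.
rewrite size_MXaddC (negPf p0) /= -{1}sp.
rewrite !(rmorphD, rmorphM, rmorphXn) /= Hq // !eval_polyX !eval_polyC.
have : z ^+ (size p).-1 * z^-1 ^+ (size p).-1 = 1.
  by rewrite -exprMn mulfV // expr1n.
rewrite exprS; move: (z ^+ _) (z^-1 ^+ _) => X1 X2 X12.
transitivity (z * X1 * (j (lead_coef p) + z^-1 * eval_poly j z^-1 q) +
  z / z * (X1 * X2) * j c); last by ring.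
by rewrite X12 mulfV //; ring.
Qed.

(** The factor theorem in Y at [w], then in X at 0: the ideal of the point (0, w) is generated by X
    and Y - w. *)
Lemma taylorXY (L : fieldType) (H : {poly {poly L}}) (w : L) :
  exists H1 H2, H = (H.[w%:P].[0])%:P%:P + 'X%:P * H1 +
                    ('X - w%:P%:P) * H2.
Proof.
have /factor_theorem[H2 E2] : root (H - H.[w%:P]%:P) w%:P.
  by rewrite rootE !hornerE subrr.
have /factor_theorem[h1 E1] : root (H.[w%:P] - H.[w%:P].[0]%:P) 0.
  by rewrite rootE !hornerE subrr.
exists h1%:P, H2; rewrite subr0 in E1.
rewrite [_ * H2]mulrC -E2 [_%:P * _]mulrC -polyCM -E1 polyCB; ring.
Qed.

(** * Subalgebras of a field and their ideals *)

Definition subalgebra_set (L K : fieldType) (j : L -> K) (O : set K) : Prop :=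
  [/\ forall c, O (j c), forall u v, O u -> O v -> O (u - v)
    & forall u v, O u -> O v -> O (u * v)].

Definition ideal_set (K : fieldType) (O I : set K) : Prop :=
  (forall u v, I u -> I v -> I (u - v)) /\ (forall u v, O u -> I v -> I (u * v)).

Section Subalgebra.
Variables (L K : fieldType) (j : {rmorphism L -> K}) (O : set K).
Hypothesis O_alg : subalgebra_set j O.

Lemma subalgebra_const c : O (j c). Proof. by case: O_alg. Qed.
Lemma subalgebra_sub u v : O u -> O v -> O (u - v).
Proof. by case: O_alg => _ + _; apply. Qed.
Lemma subalgebra_mul u v : O u -> O v -> O (u * v).
Proof. by case: O_alg => _ _; apply. Qed.
Lemma subalgebra0 : O 0. Proof. by rewrite -(rmorph0 j); apply: subalgebra_const. Qed.
Lemma subalgebra1 : O 1. Proof. by rewrite -(rmorph1 j); apply: subalgebra_const. Qed.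
Lemma subalgebra_opp u : O u -> O (- u).
Proof. by move=> Ou; rewrite -sub0r; apply: subalgebra_sub => //; apply: subalgebra0. Qed.
Lemma subalgebra_add u v : O u -> O v -> O (u + v).
Proof.
by move=> Ou Ov; rewrite -(opprK v); apply: subalgebra_sub => //; apply: subalgebra_opp.
Qed.
Lemma subalgebra_exp u n : O u -> O (u ^+ n).
Proof.
move=> Ou; elim: n => [|n IHn]; first exact: subalgebra1.
by rewrite exprS; apply: subalgebra_mul.
Qed.

Lemma subalgebra_eval_poly s p : O s -> O (eval_poly j s p).
Proof.
move=> Os; elim/poly_ind: p => [|p c IHp]; first by rewrite rmorph0; apply: subalgebra0.
rewrite rmorphD rmorphM /= eval_polyX eval_polyC.
by apply: subalgebra_add; [apply: subalgebra_mul|apply: subalgebra_const].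
Qed.

Lemma subalgebra_evalXY s z A : O s -> O z -> O (evalXY j s z A).
Proof.
move=> Os Oz; elim/poly_ind: A => [|A p IHA].
  by rewrite rmorph0; apply: subalgebra0.
rewrite rmorphD rmorphM /= evalXY_Y evalXY_polyC.
by apply: subalgebra_add; [apply: subalgebra_mul|apply: subalgebra_eval_poly].
Qed.

Variable I : set K.
Hypothesis I_ideal : ideal_set O I.

Lemma ideal_set0 v : I v -> I 0.
Proof. by case: I_ideal => IB _; move=> Iv; rewrite -(subrr v); apply: IB. Qed.

Lemma ideal_set_add u v : I u -> I v -> I (u + v).
Proof.
case: (I_ideal) => IB _ Iu Iv; rewrite -(opprK v); apply: (IB) => //.
by rewrite -sub0r; apply: IB => //; apply: ideal_set0 Iv.
Qed.

(** By [taylorXY]. It serves twice: with [I] the nonunits of a valuation ring, and with [I] the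
    multiples of [t] in the local ring of a point at infinity. *)
Lemma ideal_evalXY s z w A : O s -> O z -> I s -> I (z - j w) ->
  I (evalXY j s z A - j A.[w%:P].[0]).
Proof.
move=> Os Oz Is Iz; have [A1 [A2 EA]] := taylorXY A w.
rewrite {1}EA !(rmorphD, rmorphM, rmorphN) /= !evalXY_polyC evalXY_Y.
rewrite eval_polyX !eval_polyC.
rewrite (_ : _ - _ = evalXY j s z A1 * s + evalXY j s z A2 * (z - j w)); last by ring.
by case: I_ideal => _ IM; apply: ideal_set_add; apply: IM => //;
  exact: subalgebra_evalXY.
Qed.

(* Since [f(x) = g(y)], at infinity [y^n / x^m] tends to the quotient of the
   leading coefficients. *)
Lemma leading_congruence (f g : {poly L}) x y u :
    f != 0 -> g != 0 -> x != 0 -> y != 0 ->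
    eval_poly j x f = eval_poly j y g ->
    u = y ^+ (size g).-1 / x ^+ (size f).-1 ->
    O x^-1 -> O y^-1 -> I x^-1 -> I y^-1 -> O u ->
  I (j (lead_coef g) * u - j (lead_coef f)).
Proof.
move=> f0 g0 x0 y0 Efg Eu Ox Oy Ix Iy Ou.
have [p Ep] := poly_at_infinity f0; have [q Eq] := poly_at_infinity g0.
case: I_ideal => IB IM.
have -> : j (lead_coef g) * u - j (lead_coef f) =
    eval_poly j x^-1 p * x^-1 - u * eval_poly j y^-1 q * y^-1.
  have xm0 : x ^+ (size f).-1 != 0 by rewrite expf_neq0.
  have E : j (lead_coef f) + x^-1 * eval_poly j x^-1 p =
      u * (j (lead_coef g) + y^-1 * eval_poly j y^-1 q).
    by apply: (mulfI xm0); rewrite -Ep // Efg Eq // Eu mulrA [_ * (_ / _)]mulrC divfK.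
  by move/eqP: E; rewrite -subr_eq0 => /eqP E; rewrite -[RHS]subr0 -E; ring.
apply: IB; apply: IM => //; first exact: subalgebra_eval_poly.
by apply: subalgebra_mul => //; exact: subalgebra_eval_poly.
Qed.
End Subalgebra.

(** * Valuation rings *)

(** The conditions of [place] for an arbitrary extension [K] of [L]; for a plane curve and its
    constants the two are convertible. *)
Definition valuation_ring (L K : fieldType) (j : L -> K) (O : set K) : Prop :=
  [/\ range j `<=` O,
      (forall u v, O u -> O v -> O (u - v) /\ O (u * v)),
      (forall z, z != 0 -> O z \/ O z^-1)
    & O != setT].

(** Zero is listed apart because [0^-1 = 0] belongs to [O]. *)
Definition nonunits (K : fieldType) (O : set K) : set K :=
  [set z | O z /\ (z = 0 \/ ~ O z^-1)].

Section ValuationRing.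
Variables (L K : fieldType) (j : {rmorphism L -> K}) (O : set K).
Hypothesis O_val : valuation_ring j O.

Lemma valuation_subalgebra : subalgebra_set j O.
Proof.
case: O_val => jO OBM _ _; split.
- by move=> c; apply: jO; exists c.
- by move=> u v Ou Ov; case: (OBM u v Ou Ov).
- by move=> u v Ou Ov; case: (OBM u v Ou Ov).
Qed.
Let O_alg := valuation_subalgebra.

Lemma valuation_total z : z != 0 -> O z \/ O z^-1.
Proof. by case: O_val => _ _ + _; apply. Qed.

Lemma nonunits1 : ~ nonunits O 1.
Proof.
case=> _ [/eqP|]; first by rewrite oner_eq0.
by rewrite invr1; apply; apply: subalgebra1 O_alg.
Qed.

Lemma nonunits_inv z : ~ O z -> nonunits O z^-1.
Proof.
move=> Oz; have z0 : z != 0.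
  by apply: contra_notN Oz => /eqP->; apply: subalgebra0 O_alg.
split; last by right; rewrite invrK.
by case: (valuation_total z0).
Qed.

Lemma valuation_unit z : O z -> ~ nonunits O z -> O z^-1.
Proof.
by move=> Oz nz; apply: contrapT => nOz; apply: nz; split=> //; right.
Qed.

(** For differences: one of [u / v] and [v / u] lies in [O], so [u - v] is an [O]-multiple of [v] or
    of [u]. *)
Lemma nonunits_ideal : ideal_set O (nonunits O).
Proof.
have IM u v : O u -> nonunits O v -> nonunits O (u * v).
  move=> Ou [Ov nv]; split; first exact: (subalgebra_mul O_alg).
  have [uv0|uv0] := eqVneq (u * v) 0; [by left|right=> Ouv].
  move: uv0; rewrite mulf_eq0 negb_or => /andP[u0 v0].
  case: nv => [/eqP|]; rewrite ?(negPf v0) //; apply.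
  rewrite (_ : v^-1 = u * (u * v)^-1); first exact: (subalgebra_mul O_alg).
  by field; rewrite ?u0 ?v0.
split=> // u v Iu Iv.
have [->|v0] := eqVneq v 0; first by rewrite subr0.
have [->|u0] := eqVneq u 0.
  rewrite sub0r -mulN1r; apply: IM => //; apply: (subalgebra_opp O_alg).
  exact: (subalgebra1 O_alg).
have [Ouv|] : O (u / v) \/ O (u / v)^-1.
- by apply: valuation_total; rewrite mulf_neq0 ?invr_eq0.
- rewrite (_ : u - v = (u / v - 1) * v); last by field.
  by apply: IM => //; apply: (subalgebra_sub O_alg) => //; exact: (subalgebra1 O_alg).
rewrite invf_div => Ovu.
rewrite (_ : u - v = (1 - v / u) * u); last by field.
by apply: IM => //; apply: (subalgebra_sub O_alg) => //; exact: (subalgebra1 O_alg).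
Qed.

Lemma nonunits_mul u v : O u -> nonunits O v -> nonunits O (u * v).
Proof. by case: nonunits_ideal => _; apply. Qed.

Lemma nonunits_const c : nonunits O (j c) -> c = 0.
Proof.
move=> mc; apply/eqP; apply: contra_notT nonunits1 => c0.
rewrite -(rmorph1 j) -(mulVf c0) rmorphM; apply: nonunits_mul => //.
exact: (subalgebra_const O_alg).
Qed.

Lemma nonunits_prime u v :
  O u -> nonunits O (u * v) -> nonunits O u \/ nonunits O v.
Proof.
move=> Ou muv; case: (pselect (nonunits O u)) => [|nu]; [by left|right].
have u0 : u != 0 by apply/eqP => u0; apply: nu; split=> //; left.
by rewrite -(mulKf u0 v); apply: nonunits_mul => //; apply: valuation_unit.
Qed.

Lemma valuation_root z n : (0 < n)%N -> O (z ^+ n) -> O z.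
Proof.
move=> n0 Ozn; apply: contrapT => nOz; apply: nonunits1.
have z0 : z != 0.
  by apply: contra_notN nOz => /eqP->; apply: subalgebra0 O_alg.
have := nonunits_inv nOz; case: n n0 Ozn => // n _ Ozn mz.
rewrite -(mulfV (expf_neq0 n.+1 z0)) -exprVn; apply: nonunits_mul => //.
rewrite exprSr; apply: nonunits_mul => //; apply: (subalgebra_exp O_alg).
by case: mz.
Qed.

Lemma nonunits_prod (s : seq L) z : O z ->
  nonunits O (\prod_(w <- s) (z - j w)) -> exists2 w, w \in s & nonunits O (z - j w).
Proof.
move=> Oz; elim: s => [|w s IHs]; first by rewrite big_nil => /nonunits1.
rewrite big_cons => /nonunits_prime[|mw|].
- by apply: (subalgebra_sub O_alg) => //; exact: (subalgebra_const O_alg).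
- by exists w; rewrite ?mem_head.
by move=> /IHs[w' sw' mw']; exists w'; rewrite // inE sw' orbT.
Qed.

(** If [z] were outside [O], then [z^-1] would be a nonunit, and dividing the monic equation by the
    top power of [z] would write 1 as a sum of nonunits. *)
Lemma valuation_integrally_closed (p : {poly K}) z :
  p \is monic -> (forall i, O p`_i) -> root p z -> O z.
Proof.
move=> mp Op rz; apply: contrapT => nOz; apply: nonunits1.
have mz := nonunits_inv nOz.
have z0 : z != 0.
  by apply: contra_notN nOz => /eqP->; apply: subalgebra0 O_alg.
have p0 : p != 0 by rewrite monic_neq0.
case Ep : (size p) => [|n]; first by move/eqP: Ep; rewrite size_poly_eq0 (negPf p0).
move: rz; rewrite rootE horner_coef Ep big_ord_recr /=.
have -> : p`_n = 1 by move/monicP: mp; rewrite /lead_coef Ep.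
rewrite mul1r addr_eq0 => /eqP E.
have zn0 := expf_neq0 n z0.
rewrite -(divff zn0) -[X in X / _]opprK -E -mulN1r -mulrA.
apply: nonunits_mul.
  by apply: (subalgebra_opp O_alg); exact: (subalgebra1 O_alg).
rewrite mulr_suml; elim/big_ind: _ => //.
- exact: (ideal_set0 nonunits_ideal mz).
- by move=> *; apply: (ideal_set_add nonunits_ideal).
move=> i _; rewrite (_ : _ / _ = p`_i * z^-1 ^+ (n - i).-1 * z^-1).
  apply: nonunits_mul => //; apply: (subalgebra_mul O_alg) => //.
  by apply: (subalgebra_exp O_alg); case: mz.
have lin := ltn_ord i; move: (i : nat) lin => {}i lin.
rewrite -!mulrA -exprSr prednK ?subn_gt0 // exprVn; congr (_ * _).
by rewrite -{1}(subnK (ltnW lin)) exprD invfM mulrCA mulfV ?mulr1 // expf_neq0.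
Qed.
End ValuationRing.

(** Some [t ^+ l * z] lies in [O]. Divide it by [t] as long as it is not a unit: either [l] drops to
    0 and [z] is in [O], or a unit is reached and [z^-1] is in [O]. *)
Lemma uniformized_total (K : fieldType) (O : set K) (t : K) :
    (forall u v, O u -> O v -> O (u * v)) -> O t -> O 1 ->
    (forall z, O z -> z != 0 -> O z^-1 \/ O (z / t)) -> t != 0 ->
    (forall z, exists l, O (t ^+ l * z)) ->
  forall z, z != 0 -> O z \/ O z^-1.
Proof.
move=> OM Ot O1 Ounit t0 Ofrac z z0; have [l] := Ofrac z.
have Otn n : O (t ^+ n) by elim: n => // n IHn; rewrite exprS; apply: OM.
elim: l => [|l IHl] Oz; first by left; rewrite mul1r in Oz.
have [|Oi|] := Ounit _ Oz; first by rewrite mulf_neq0 // expf_neq0.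
  right; rewrite (_ : z^-1 = t ^+ l.+1 * (t ^+ l.+1 * z)^-1); first exact: OM.
  by rewrite invfM mulVKf // expf_neq0.
rewrite (_ : _ / t = t ^+ l * z); first exact: IHl.
by rewrite exprS; field.
Qed.

(** The exponents of [t] and [u] in [x] and [y] form a matrix of determinant aN - bM = -1, so the
    monomial change of coordinates is invertible over the integers. *)
Lemma monomial_chart (K : fieldType) (x y : K) M N a b :
    x != 0 -> y != 0 -> (b * M)%N = (a * N).+1 ->
  let t := x ^+ a / y ^+ b in let u := y ^+ N / x ^+ M in
  x^-1 = t ^+ N * u ^+ b /\ y^-1 = t ^+ M * u ^+ a.
Proof.
move=> x0 y0 bM_aN /=; rewrite !exprMn !exprVn -!exprM bM_aN.
rewrite [(M * b)%N]mulnC bM_aN [(b * N)%N]mulnC [(M * a)%N]mulnC [(a * N)%N]mulnC.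
have xn n : x ^+ n != 0 by exact: expf_neq0.
have yn n : y ^+ n != 0 by exact: expf_neq0.
rewrite !exprSr; split; field; rewrite ?x0 ?y0 ?xn ?yn //.
Qed.

(** * Places at infinity in the toric chart *)

(** [z] is a root of [p] minus its value at [z], which becomes monic over [O] after division by the
    leading coefficient. *)
Lemma valuation_eval_poly (L K : fieldType) (j : {rmorphism L -> K}) (O : set K)
    (p : {poly L}) z :
  valuation_ring j O -> (1 < size p)%N -> O (eval_poly j z p) -> O z.
Proof.
move=> Ov sp Opz; have Oa := valuation_subalgebra Ov.
have p0 : p != 0 by rewrite -size_poly_gt0 (ltn_trans _ sp).
have l0 : lead_coef p != 0 by rewrite lead_coef_eq0.
pose r := map_poly j (p * (lead_coef p)^-1%:P) -
  (eval_poly j z p * j (lead_coef p)^-1)%:P.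
apply: (valuation_integrally_closed Ov (p := r)).
- apply/monicP; rewrite /r lead_coefDl ?lead_coef_map ?lead_coefM ?lead_coefC.
    by rewrite mulfV // rmorph1.
  rewrite size_polyN size_map_poly [p * _]mulrC mul_polyC size_scale ?invr_eq0 //.
  exact: leq_ltn_trans (size_polyC_leq1 _) sp.
- move=> i; rewrite /r coefB coef_map coefC; apply: (subalgebra_sub Oa).
    exact: (subalgebra_const Oa).
  case: ifP => _; last exact: (subalgebra0 Oa).
  by apply: (subalgebra_mul Oa) => //; exact: (subalgebra_const Oa).
rewrite rootE /r hornerD hornerN hornerC rmorphM /= map_polyC hornerM hornerC.
by rewrite subrr.
Qed.

Section Infinity.
Variables (L K : fieldType) (j : {rmorphism L -> K}).
Variables (x y t u : K) (f g : {poly L}) (M N e a b : nat).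
Hypotheses (sf : (1 < size f)%N) (sg : (1 < size g)%N).
Hypothesis fg : eval_poly j x f = eval_poly j y g.
Hypotheses (x0 : x != 0) (y0 : y != 0) (t0 : t != 0).
Hypotheses (xV : x^-1 = t ^+ N * u ^+ b) (yV : y^-1 = t ^+ M * u ^+ a).
Hypothesis ue : u ^+ e = y ^+ (size g).-1 / x ^+ (size f).-1.
Hypotheses (M_gt0 : (0 < M)%N) (N_gt0 : (0 < N)%N) (e_neq0 : e%:R != 0 :> L).
Hypothesis L_closed : forall p : {poly L},
  exists s : seq L, p = lead_coef p *: \prod_(w <- s) ('X - w%:P).
Hypothesis xy_generate :
  forall z, exists U r, r != 0 /\ z = evalXY j x y U / eval_poly j x r.

Local Notation psi := (evalXY j t u).

Let f0 : f != 0. Proof. by rewrite -size_poly_gt0 (ltn_trans _ sf). Qed.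
Let g0 : g != 0. Proof. by rewrite -size_poly_gt0 (ltn_trans _ sg). Qed.
Let lf0 : lead_coef f != 0. Proof. by rewrite lead_coef_eq0. Qed.
Let lg0 : lead_coef g != 0. Proof. by rewrite lead_coef_eq0. Qed.
Let e_gt0 : (0 < e)%N.
Proof. by rewrite lt0n; apply: contra_neq e_neq0 => ->. Qed.

(** These are the candidate values of [u] at infinity, since [u ^+ e] tends to this quotient. *)
Definition branch_value (w : L) : Prop := w ^+ e = lead_coef f / lead_coef g.

Lemma branch_value_neq0 w : branch_value w -> w != 0.
Proof.
move=> Hw; apply: contraTneq (mulf_neq0 lf0 (invr_neq0 lg0)) => w0.
by rewrite -Hw w0 expr0n eqn0Ngt e_gt0 eqxx.
Qed.

(* [(0, w)] lies on the closure of the curve in the chart with coordinates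
   [t] and [u]. *)
Definition point_at_infinity (w : L) : Prop :=
  forall H, psi H = 0 -> H.[w%:P].[0] = 0.

(** Both coordinates have poles at [O], so [u ^+ e] is congruent to the quotient of leading
    coefficients. Splitting X^e minus that quotient into linear factors, one factor is a nonunit at
    [u]. *)
Lemma infinite_place_branch O : valuation_ring j O -> ~ O x ->
  exists w, [/\ branch_value w, O u, nonunits O t & nonunits O (u - j w)].
Proof.
move=> Ov nOx; have Oa := valuation_subalgebra Ov.
have nOy : ~ O y.
  move=> Oy; apply: nOx; apply: (valuation_eval_poly Ov sf).
  by rewrite fg; apply: (subalgebra_eval_poly Oa).
have mI := nonunits_ideal Ov.
have mx := nonunits_inv Ov nOx; have my := nonunits_inv Ov nOy.
(* Otherwise the congruence with the roles of [f] and [g] exchanged, applied to the nonunit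
   [(u ^+ e)^-1], would make the leading coefficient of [g] a nonunit. *)
have Oue : O (u ^+ e).
  apply: contrapT => /(nonunits_inv Ov) mU.
  have := leading_congruence Oa mI g0 f0 y0 x0 (esym fg)
    (erefl (x ^+ (size f).-1 / y ^+ (size g).-1)) my.1 mx.1 my mx.
  rewrite -[x ^+ _ / _]invf_div -ue => /(_ mU.1) mB.
  have /eqP := lg0; apply; apply: (nonunits_const Ov).
  rewrite (_ : j _ = j (lead_coef f) * (u ^+ e)^-1 -
    (j (lead_coef f) * (u ^+ e)^-1 - j (lead_coef g))); last by ring.
  by case: mI => mB' mM; apply: mB' => //; apply: mM => //; exact: (subalgebra_const Oa).
have Ou := valuation_root Ov e_gt0 Oue.
have mU : nonunits O (j (lead_coef g) * u ^+ e - j (lead_coef f)).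
  exact: (leading_congruence Oa mI f0 g0 x0 y0 fg ue mx.1 my.1 mx my).
pose c := lead_coef f / lead_coef g.
have [s Es] := L_closed ('X^e - c%:P).
have mp : 'X^e - c%:P \is monic by apply: monicXnsubC.
rewrite (monicP mp) scale1r in Es.
have [w sw mw] : exists2 w, w \in s & nonunits O (u - j w).
  apply: (nonunits_prod Ov Ou).
  have -> : \prod_(w <- s) (u - j w) = eval_poly j u ('X^e - c%:P).
    rewrite Es rmorph_prod; apply: eq_bigr => w _.
    by rewrite /= eval_polyB eval_polyX eval_polyC.
  rewrite eval_polyB rmorphXn /= eval_polyX eval_polyC.
  rewrite (_ : _ - _ = j (lead_coef g)^-1 * (j (lead_coef g) * u ^+ e - j (lead_coef f))).
    by apply: (nonunits_mul Ov) => //; exact: (subalgebra_const Oa).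
  rewrite mulrBr mulrA -!rmorphM mulVf // rmorph1 mul1r; congr (_ - j _).
  by rewrite mulrC.
have Hw : branch_value w.
  have : root ('X^e - c%:P) w by rewrite Es root_prod_XsubC.
  by rewrite rootE !hornerE subr_eq0 => /eqP.
have Oui : O u^-1.
  apply: (valuation_unit Ou) => mu; have /eqP := branch_value_neq0 Hw; apply.
  apply: (nonunits_const Ov); rewrite (_ : j w = u - (u - j w)); last by ring.
  by case: mI => mB _; apply: mB.
(* [x] is a product of powers of [t^-1] and [u^-1], and [u] is a unit because [w] is nonzero. *)
have nOt : ~ O t^-1.
  move=> Oti; apply: nOx; rewrite -[x]invrK xV invfM -!exprVn.
  by apply: (subalgebra_mul Oa); apply: (subalgebra_exp Oa).
exists w; split=> //; split; last by right.
by case: (valuation_total Ov t0).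
Qed.

(** H(t, u) is congruent to the constant H(0, w) modulo the nonunits, and zero is the only nonunit
    constant. *)
Lemma infinite_place_point O w : valuation_ring j O ->
  O u -> nonunits O t -> nonunits O (u - j w) -> point_at_infinity w.
Proof.
move=> Ov Ou mt mw H H0; apply: (nonunits_const Ov).
have := ideal_evalXY (valuation_subalgebra Ov) (nonunits_ideal Ov) H mt.1 Ou mt mw.
rewrite H0 sub0r => mH; rewrite -[j _]opprK -mulN1r; apply: (nonunits_mul Ov) => //.
apply: (subalgebra_opp (valuation_subalgebra Ov)).
exact: (subalgebra1 (valuation_subalgebra Ov)).
Qed.

(** The local ring at (0, w) of the closure of the curve in the chart with coordinates [t] and
    [u]. *)
Definition branch_ring (w : L) : set K :=
  [set z | exists A B, B.[w%:P].[0] != 0 /\ z = psi A / psi B].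

Section Branch.
Variable w : L.
Hypotheses (w_inf : point_at_infinity w) (w_branch : branch_value w).
Let R := branch_ring w.
(** The principal ideal generated by [t]; [R_local] shows that it contains every nonunit of [R]. *)
Let tR : set K := [set z | R (z / t)].

Let psi_neq0 B : B.[w%:P].[0] != 0 -> psi B != 0.
Proof. by apply: contra_neq => /w_inf. Qed.

Let R_psi A : R (psi A).
Proof. by exists A, 1; rewrite !hornerE oner_neq0 rmorph1 divr1. Qed.

Let R_alg : subalgebra_set j R.
Proof.
split.
- by move=> c; have := R_psi c%:P%:P; rewrite evalXY_polyC eval_polyC.
- move=> _ _ [A [B [B0 ->]]] [A' [B' [B0' ->]]].
  exists (A * B' - A' * B), (B * B'); rewrite !hornerM mulf_neq0 //; split=> //.
  have BK := psi_neq0 B0; have BK' := psi_neq0 B0'.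
  rewrite evalXYB !evalXYM.
  move: BK BK'.
  move: (psi A) (psi B) (psi A') (psi B') => p q p' q' q0 q0'.
  by field; rewrite q0 q0'.
move=> _ _ [A [B [B0 ->]]] [A' [B' [B0' ->]]].
exists (A * A'), (B * B'); rewrite !hornerM mulf_neq0 //; split=> //.
by rewrite !evalXYM invfM mulrACA.
Qed.

Let Rt : R t.
Proof. by have := R_psi 'X%:P; rewrite evalXY_polyC eval_polyX. Qed.
Let Ru : R u.
Proof. by have := R_psi 'X; rewrite evalXY_Y. Qed.

Let R_unit B : B.[w%:P].[0] != 0 -> R (psi B)^-1.
Proof. by move=> B0; exists 1, B; rewrite rmorph1 mul1r. Qed.

Let Rui : R u^-1.
Proof.
have := @R_unit 'X; rewrite !hornerE (branch_value_neq0 w_branch) => /(_ isT).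
by rewrite evalXY_Y.
Qed.

(** If 1/t = A/B, then B - AX vanishes on the curve, yet its value at (0, w) is B(0, w), which is
    nonzero. *)
Let nRti : ~ R t^-1.
Proof.
move=> [A [B [B0]]]; have BK := psi_neq0 B0 => E.
have : psi (B - A * 'X%:P) = 0.
  rewrite evalXYB evalXYM evalXY_polyC eval_polyX; apply/eqP.
  by rewrite subr_eq0 -(inj_eq (mulIf (invr_neq0 BK))) mulfV // mulrAC -E mulVf.
by move/w_inf; rewrite !hornerE => /eqP; rewrite ?mulr0 ?subr0 (negPf B0).
Qed.

Let tR_ideal : ideal_set R tR.
Proof.
split=> [v v'|v v'] Rv Rv'; rewrite /tR /=.
  by rewrite mulrBl; apply: (subalgebra_sub R_alg).
by rewrite -mulrA; apply: (subalgebra_mul R_alg).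
Qed.

Let tR_t v : R v -> tR (t * v).
Proof. by rewrite /tR /= mulrAC mulfV // mul1r. Qed.

Let tR_const c : tR (j c) -> c = 0.
Proof.
move=> tc; apply/eqP; apply: contra_notT nRti => c0.
rewrite -[t^-1]mul1r -(rmorph1 j) -(mulVf c0) rmorphM -mulrA.
by apply: (subalgebra_mul R_alg) => //; apply: (subalgebra_const R_alg).
Qed.

Let RxV : R x^-1 /\ tR x^-1.
Proof.
suff : tR x^-1.
  split=> //; rewrite -[x^-1](divfK t0); exact: (subalgebra_mul R_alg).
rewrite xV -(prednK N_gt0) exprS -mulrA; apply: tR_t.
by apply: (subalgebra_mul R_alg); apply: (subalgebra_exp R_alg).
Qed.

Let RyV : R y^-1 /\ tR y^-1.
Proof.
suff : tR y^-1.
  split=> //; rewrite -[y^-1](divfK t0); exact: (subalgebra_mul R_alg).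
rewrite yV -(prednK M_gt0) exprS -mulrA; apply: tR_t.
by apply: (subalgebra_mul R_alg); apply: (subalgebra_exp R_alg).
Qed.

(* [w] is a simple root of [u^e = lead_coef f / lead_coef g]. *)
Let tR_uw : tR (u - j w).
Proof.
have := leading_congruence R_alg tR_ideal f0 g0 x0 y0 fg ue
  RxV.1 RyV.1 RxV.2 RyV.2 (subalgebra_exp R_alg e Ru).
(* The cofactor of Y - w in Y^e - w^e. Its value e w^(e-1) at (0, w) is nonzero, so [psi S] is a
   unit of [R] and can be divided out of the congruence. *)
pose S : {poly {poly L}} := \sum_(i < e) 'X^(e.-1 - i) * (w ^+ i)%:P%:P.
have S0 : S.[w%:P].[0] != 0.
  have -> : S.[w%:P].[0] = e%:R * w ^+ e.-1.
    rewrite /S !horner_sum (eq_bigr (fun=> w ^+ e.-1)).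
      by rewrite sumr_const card_ord mulr_natl.
    move=> i _; rewrite !hornerE -exprD subnK //.
    by rewrite -ltnS prednK.
  by rewrite mulf_neq0 // expf_neq0 // branch_value_neq0.
have -> : j (lead_coef g) * u ^+ e - j (lead_coef f) =
    (u - j w) * psi S * j (lead_coef g).
  have -> : lead_coef f = lead_coef g * w ^+ e by rewrite w_branch mulrC divfK.
  rewrite rmorphM rmorphXn /= -mulrBr [RHS]mulrC subrXX; congr (_ * (_ * _)).
  rewrite /S rmorph_sum; apply: eq_bigr => i _.
  by rewrite rmorphM rmorphXn /= evalXY_Y evalXY_polyC eval_polyC rmorphXn.
move=> tRS; rewrite (_ : u - j w =
  (psi S)^-1 * j (lead_coef g)^-1 * ((u - j w) * psi S * j (lead_coef g))).
  case: tR_ideal => _; apply=> //; apply: (subalgebra_mul R_alg).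
    exact: R_unit.
  exact: (subalgebra_const R_alg).
have jl0 : j (lead_coef g) != 0 by rewrite fmorph_eq0.
rewrite fmorphV; have := psi_neq0 S0; move: (psi S) (j _) jl0 (u - j w) => s l l0' v s0.
by field; rewrite s0 l0'.
Qed.

(** A numerator vanishing at (0, w) lies in the ideal generated by [t] and [u - j w], and the second
    generator is itself a multiple of [t]. *)
Let R_local z : R z -> z != 0 -> R z^-1 \/ tR z.
Proof.
move=> [A [B [B0 ->]]] _; have [A0|A0] := eqVneq (A.[w%:P].[0]) 0.
  have tRt : tR t by rewrite -[t]mulr1; apply: tR_t; exact: (subalgebra1 R_alg).
  right; have := ideal_evalXY R_alg tR_ideal A Rt Ru tRt tR_uw.
  rewrite A0 rmorph0 subr0 => tA.
  by rewrite mulrC; case: tR_ideal => _; apply=> //; apply: R_unit.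
by left; exists B, A; rewrite invf_div.
Qed.

Let R_loc : subalgebra_set j [set z | exists l, R (t ^+ l * z)].
Proof.
have Rtn n : R (t ^+ n) by exact: (subalgebra_exp R_alg).
split.
- by move=> c; exists 0%N; rewrite mul1r; apply: (subalgebra_const R_alg).
- move=> v v' [l Rv] [l' Rv']; exists (l + l')%N.
  rewrite exprD mulrBr {1}[t ^+ l * _]mulrC -!mulrA.
  by apply: (subalgebra_sub R_alg); rewrite ?mulrA -?mulrA; apply: (subalgebra_mul R_alg).
move=> v v' [l Rv] [l' Rv']; exists (l + l')%N.
by rewrite exprD mulrACA; apply: (subalgebra_mul R_alg).
Qed.

(** [K] is R[1/t]: [x] and [y] are inverse monomials in [t] and the unit [u], and the inverse of a
    nonzero polynomial in [x] already lies in [R]. *)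
Let R_frac z : exists l, R (t ^+ l * z).
Proof.
have [U [r [r0 ->]]] := xy_generate z.
have zloc v n k : (0 < n)%N -> v^-1 = t ^+ n * u ^+ k -> exists l, R (t ^+ l * v).
  move=> _ Ev; exists n; rewrite -[v]invrK Ev invfM mulVKf ?expf_neq0 //.
  by rewrite -exprVn; apply: (subalgebra_exp R_alg).
apply: (subalgebra_mul R_loc).
  apply: (subalgebra_evalXY R_loc); first exact: (zloc _ _ _ N_gt0 xV).
  exact: (zloc _ _ _ M_gt0 yV).
exists 0%N; rewrite mul1r.
have [q Eq] := poly_at_infinity r0; rewrite Eq // invfM -exprVn.
apply: (subalgebra_mul R_alg); first exact: (subalgebra_exp R_alg _ RxV.1).
(* [z'] is a nonzero constant plus a multiple of [t], hence a unit of [R]. *)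
set z' := j _ + _.
have tq : tR (x^-1 * eval_poly j x^-1 q).
  rewrite mulrC; case: tR_ideal => _; apply; last exact: RxV.2.
  exact: (subalgebra_eval_poly R_alg _ RxV.1).
have nz' : ~ tR z'.
  move=> tz'; have /eqP := r0; apply; apply/eqP; rewrite -lead_coef_eq0; apply/eqP.
  apply: tR_const; rewrite (_ : j _ = z' - x^-1 * eval_poly j x^-1 q).
    by case: tR_ideal => tB _; apply: tB.
  by rewrite /z' addrK.
have Rz' : R z'.
  apply: (subalgebra_add R_alg); first exact: (subalgebra_const R_alg).
  by rewrite -[_ * _](divfK t0); apply: (subalgebra_mul R_alg).
have z'0 : z' != 0.
  by apply: contra_notN nz' => /eqP->; rewrite /tR /= mul0r; apply: (subalgebra0 R_alg).
by case: (R_local Rz' z'0).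
Qed.

Let R_total z : z != 0 -> R z \/ R z^-1.
Proof.
apply: (uniformized_total (t := t)) => //.
- by move=> *; apply: (subalgebra_mul R_alg).
- exact: (subalgebra1 R_alg).
Qed.

Lemma branch_ring_valuation : valuation_ring j (branch_ring w).
Proof.
split.
- by move=> _ [c _ <-]; apply: (subalgebra_const R_alg).
- move=> v v' Rv Rv'; split; first exact: (subalgebra_sub R_alg).
  exact: (subalgebra_mul R_alg).
- exact: R_total.
by apply/eqP => RT; apply: nRti; rewrite /R RT.
Qed.

Lemma branch_ring_infinite : ~ branch_ring w x.
Proof.
move=> Rx; apply/nRti; rewrite -[t^-1]mul1r -(mulfV x0) -mulrA.
by apply: (subalgebra_mul R_alg) => //; exact: RxV.2.
Qed.

(** The ring determines the residue of [u]: two residues differ by a constant multiple of [t], which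
    must be zero. *)
Lemma branch_ring_value w' : branch_ring w ((u - j w') / t) -> w' = w.
Proof.
move=> Rw'; apply/eqP; rewrite -subr_eq0; apply/eqP; apply: tR_const.
rewrite (_ : j _ = (u - j w) - (u - j w')); last by rewrite rmorphB; ring.
by case: tR_ideal => tB _; apply: tB.
Qed.

Lemma branch_ring_uw : branch_ring w ((u - j w) / t).
Proof. exact: tR_uw. Qed.

(** [O] contains [R], as denominators that are nonzero at (0, w) are units of [O]. For [z] in [O]
    outside [R], the inverse [z^-1] is a multiple of [t] in [R], which would put [t^-1] in [O]. *)
Lemma branch_ring_unique O : valuation_ring j O ->
  O u -> nonunits O t -> nonunits O (u - j w) -> O = branch_ring w.
Proof.
move=> Ov Ou mt mw; have Oa := valuation_subalgebra Ov.
have Opsi A : O (psi A) by apply: (subalgebra_evalXY Oa) => //; exact: mt.1.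
have RO z : R z -> O z.
  move=> [A [B [B0 ->]]]; apply: (subalgebra_mul Oa) => //.
  apply: valuation_unit => // mB; have /eqP := B0; apply.
  apply: (nonunits_const Ov).
  rewrite (_ : j _ = psi B - (psi B - j B.[w%:P].[0])); last by ring.
  case: (nonunits_ideal Ov) => mBB _; apply: mBB => //.
  exact: (ideal_evalXY Oa (nonunits_ideal Ov) B mt.1 Ou mt mw).
rewrite eqEsubset; split=> // z Oz; apply: contrapT => nRz.
have z0 : z != 0.
  by apply: contra_notN nRz => /eqP->; apply: (subalgebra0 R_alg).
have Rzi : R z^-1 by case: (R_total z0).
have [||] := R_local Rzi; rewrite ?invr_eq0 ?invrK // => tz.
apply: (nonunits1 Ov); rewrite -(mulVf t0).
apply: (nonunits_mul Ov) => //.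
rewrite -[t^-1]mul1r -(mulfV z0) -mulrA; apply: (subalgebra_mul Oa) => //.
exact: RO.
Qed.
End Branch.

Lemma branch_ring_inj w w' : point_at_infinity w -> branch_value w ->
  point_at_infinity w' -> branch_value w' ->
  branch_ring w = branch_ring w' -> w = w'.
Proof.
move=> iw vw iw' vw' E; apply: branch_ring_value iw' vw' _ _.
by rewrite -E; apply: branch_ring_uw.
Qed.

Lemma infinite_placesE :
  [set O | valuation_ring j O /\ ~ O x] =
  branch_ring @` [set w | point_at_infinity w /\ branch_value w].
Proof.
rewrite eqEsubset; split=> [O [Ov nOx]|_ [w [iw vw] <-]]; last first.
  by split; [apply: branch_ring_valuation|apply: branch_ring_infinite].
have [w [vw Ou mt mw]] := infinite_place_branch Ov nOx.
have iw := infinite_place_point Ov Ou mt mw.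
by exists w => //; apply/esym; exact: branch_ring_unique.
Qed.
End Infinity.

(** * Weighted initial forms *)

Section Monomials.
Variable L : fieldType.

(** The exponents are arbitrary functions of the indices, so a monomial change of coordinates can be
    carried out term by term. *)
Definition monomialsXY (I J : nat) (c : nat -> nat -> L) (p q : nat -> nat -> nat) :
    {poly {poly L}} :=
  \sum_(l < J) \sum_(i < I) (c i l)%:P%:P * ('X^(p i l))%:P * 'X^(q i l).

Lemma evalXY_monomials (S : comNzRingType) (j : {rmorphism L -> S}) s z I J c p q :
  evalXY j s z (monomialsXY I J c p q) =
  \sum_(l < J) \sum_(i < I) j (c i l) * s ^+ p i l * z ^+ q i l.
Proof.
rewrite /monomialsXY rmorph_sum; apply: eq_bigr => l _.
rewrite rmorph_sum; apply: eq_bigr => i _ /=.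
by rewrite !evalXYM !evalXY_polyC eval_polyC !rmorphXn /= evalXY_Y eval_polyX.
Qed.

Lemma monomialsXYE (A : {poly {poly L}}) I J :
  (size A <= J)%N -> (sizeY A <= I)%N ->
  A = monomialsXY I J (fun i l => A`_l`_i) (fun i _ => i) (fun _ l => l).
Proof.
have coefKw (R : nzSemiRingType) (p : {poly R}) n :
    (size p <= n)%N -> p = \sum_(i < n) p`_i *: 'X^i.
  move=> sp; rewrite -{1}[p]coefK poly_def (big_ord_widen _ (fun i => p`_i *: 'X^i) sp).
  rewrite big_mkcond; apply: eq_bigr => i _; case: ltnP => // si.
  by rewrite nth_default // scale0r.
move=> sJ sI; rewrite {1}(coefKw _ A J sJ); apply: eq_bigr => l _.
rewrite -mul_polyC -mulr_suml; congr (_ * _).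
have sA : (size (A`_l)%R <= I)%N by exact: leq_trans (max_size_coefXY _ _) sI.
rewrite {1}(coefKw _ _ I sA) rmorph_sum; apply: eq_bigr => i _ /=.
by rewrite -mul_polyC polyCM.
Qed.

Lemma horner2_evalXY (A : {poly {poly L}}) (s w : L) :
  A.[w%:P].[s] = evalXY idfun s w A.
Proof.
elim/poly_ind: A => [|A p IHA]; first by rewrite rmorph0 !horner0.
rewrite rmorphD /= evalXYM evalXY_Y evalXY_polyC -IHA !hornerE; congr (_ + _).
elim/poly_ind: p => [|p c IHp]; first by rewrite rmorph0 horner0.
by rewrite rmorphD rmorphM /= eval_polyX eval_polyC -IHp !hornerE.
Qed.

Variables M N : nat.
Hypotheses (M_gt0 : (0 < M)%N) (N_gt0 : (0 < N)%N).

(* The outer variable records the weighted degree with weights [N] and [M] of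
   [X] and [Y], the inner one the degree in [Y]. *)
Definition weigh : {poly {poly L}} -> {poly {poly L}} :=
  evalXY (polyC \o polyC) 'X^N ('X%:P * 'X^M).
HB.instance Definition _ := GRing.RMorphism.on weigh.

Lemma weigh_monomials I J c p q :
  weigh (monomialsXY I J c p q) = \sum_(l < J) \sum_(i < I)
    (c i l *: 'X^(q i l))%:P * 'X^(N * p i l + M * q i l).
Proof.
rewrite /weigh evalXY_monomials; apply: eq_bigr => l _; apply: eq_bigr => i _ /=.
rewrite exprMn -!exprM exprD -mul_polyC polyCM rmorphXn /=; ring.
Qed.

Lemma coef_weigh_monomials I J c p q k :
  (weigh (monomialsXY I J c p q))`_k = \sum_(l < J) \sum_(i < I)
    (c i l * (k == N * p i l + M * q i l)%N%:R) *: 'X^(q i l).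
Proof.
rewrite weigh_monomials coef_sum; apply: eq_bigr => l _.
rewrite coef_sum; apply: eq_bigr => i _; rewrite coefCM coefXn.
by case: eqP => _; rewrite ?mulr1 ?mulr0 ?scale0r.
Qed.

Lemma size_coef_weigh (A : {poly {poly L}}) k : (size ((weigh A)`_k)%R <= size A)%N.
Proof.
rewrite {1}(monomialsXYE (leqnn (size A)) (leqnn (sizeY A))) coef_weigh_monomials.
apply: (leq_trans (size_sum _ _ _)); apply/bigmax_leqP => l _.
apply: (leq_trans (size_sum _ _ _)); apply/bigmax_leqP => i _.
apply: (leq_trans (size_scale_leq _ _)); rewrite size_polyXn; exact: ltn_ord.
Qed.

(** The weight and the degree in Y determine the degree in X because [N] is positive; hence [weigh]
    loses no information. *)
Lemma coef_coef_weigh (A : {poly {poly L}}) i l :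
  (weigh A)`_(N * i + M * l)`_l = A`_l`_i.
Proof.
have lJ : (size A <= maxn (size A) l.+1)%N by rewrite leq_maxl.
have iI : (sizeY A <= maxn (sizeY A) i.+1)%N by rewrite leq_maxl.
rewrite {1}(monomialsXYE lJ iI) coef_weigh_monomials coef_sum.
have lJ' : (l < maxn (size A) l.+1)%N by rewrite leq_maxr.
have iI' : (i < maxn (sizeY A) i.+1)%N by rewrite leq_maxr.
rewrite (bigD1 (Ordinal lJ')) //= [X in _ + X]big1 ?addr0 => [|l' /eqP ll'].
  rewrite coef_sum (bigD1 (Ordinal iI')) //= [X in _ + X]big1 ?addr0 => [|i' /eqP ii'].
    by rewrite coefZ coefXn !eqxx !mulr1.
  rewrite eqn_add2r eqn_mul2l eqn0Ngt N_gt0 /=.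
  case: eqP => [E|]; first by case: ii'; apply: val_inj.
  by rewrite mulr0 scale0r coef0.
rewrite coef_sum big1 // => i' _; rewrite coefZ coefXn.
have -> : (l == l' :> nat) = false; last by rewrite mulr0.
by apply/eqP => E; case: ll'; apply: val_inj.
Qed.

Lemma weigh_eq0 A : (weigh A == 0) = (A == 0).
Proof.
apply/eqP/eqP => [W0|->]; last exact: rmorph0.
by apply/polyP => l; apply/polyP => i; rewrite -coef_coef_weigh W0 !coef0.
Qed.

(** The part of top weight dehomogenized at X = 1: a polynomial in Y, carried by the inner
    variable. *)
Definition initial_form (A : {poly {poly L}}) : {poly L} := lead_coef (weigh A).

Lemma initial_formM A B : initial_form (A * B) = initial_form A * initial_form B.
Proof. by rewrite /initial_form rmorphM lead_coefM. Qed.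

Lemma initial_form_eq0 A : (initial_form A == 0) = (A == 0).
Proof. by rewrite lead_coef_eq0 weigh_eq0. Qed.

Lemma size_initial_form A : (size (initial_form A) <= size A)%N.
Proof. exact: size_coef_weigh. Qed.

Lemma initial_formE A d :
  (size (weigh A) <= d.+1)%N -> (weigh A)`_d != 0 -> initial_form A = (weigh A)`_d.
Proof.
move=> sA A0; have sd : size (weigh A) = d.+1.
  by apply/eqP; rewrite eqn_leq sA ltnNge; apply: contra_neqN A0 => /leq_sizeP->.
by rewrite /initial_form lead_coefE sd.
Qed.

(** The leading monomials of f(X) and g(Y) both have weight eMN, and all other monomials have
    smaller weight. *)
Lemma initial_form_curve (f g : {poly L}) e :
    (0 < e)%N -> (size f).-1 = (e * M)%N -> (size g).-1 = (e * N)%N ->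
  initial_form (curve_eqn f g) = (lead_coef f)%:P - lead_coef g *: 'X^((size g).-1).
Proof.
move=> e0 Ef Eg.
have Wf k : (weigh f%:P)`_k = \sum_(i < size f) (f`_i * (k == N * i)%N%:R)%:P.
  rewrite /weigh evalXY_polyC -{1}[f]coefK poly_def rmorph_sum coef_sum.
  apply: eq_bigr => i _; rewrite -mul_polyC rmorphM rmorphXn /= eval_polyX eval_polyC /=.
  by rewrite coefCM -exprM coefXn polyCM; case: eqP.
have Wg k : (weigh (map_poly polyC g))`_k =
    \sum_(i < size g) (g`_i * (k == M * i)%N%:R) *: 'X^i.
  rewrite /weigh evalXY_map_polyC -{1}[g]coefK poly_def rmorph_sum coef_sum.
  apply: eq_bigr => i _; rewrite -mul_polyC rmorphM rmorphXn /= eval_polyX eval_polyC /=.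
  rewrite exprMn -exprM -rmorphXn /= mulrA -polyCM coefCM coefXn mul_polyC.
  by case: eqP => _; rewrite ?mulr1 ?mulr0 ?scale0r.
have f0 : (0 < size f)%N by rewrite (leq_trans _ (leq_pred _)) // Ef muln_gt0 e0.
have g0 : (0 < size g)%N by rewrite (leq_trans _ (leq_pred _)) // Eg muln_gt0 e0.
have Wd : (weigh (curve_eqn f g))`_(e * M * N) =
    (lead_coef f)%:P - lead_coef g *: 'X^((size g).-1).
  rewrite /curve_eqn rmorphB coefB Wf Wg.
  have lf : ((size f).-1 < size f)%N by rewrite prednK.
  have lg : ((size g).-1 < size g)%N by rewrite prednK.
  rewrite (bigD1 (Ordinal lf)) //= [X in _ - X](bigD1 (Ordinal lg)) //=.
  have EN : (e * M * N = N * (size f).-1)%N by rewrite Ef mulnC.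
  have EM : (e * M * N = M * (size g).-1)%N by rewrite Eg mulnAC mulnC.
  rewrite {1}EN {2}EM !eqxx !mulr1 [X in _ + X - _]big1 ?addr0 => [|i /eqP iN].
    rewrite [X in _ - (_ + X)]big1 ?addr0 => [|i /eqP iM]; first by rewrite !lead_coefE.
    rewrite EM eqn_pmul2l //; case: eqP => [E|_]; last by rewrite mulr0 scale0r.
    by case: iM; apply: val_inj.
  rewrite EN eqn_pmul2l //; case: eqP => [E|_]; last by rewrite mulr0.
  by case: iN; apply: val_inj.
rewrite -Wd; apply: initial_formE.
  apply/leq_sizeP => k ltk; rewrite /curve_eqn rmorphB coefB Wf Wg.
  rewrite !big1 ?subr0 // => i _; rewrite gtn_eqF ?mulr0 ?scale0r //;
    apply: leq_ltn_trans ltk.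
    have -> : (e * M * N = M * (size g).-1)%N by rewrite Eg; lia.
    by rewrite leq_mul2l -ltnS prednK // ltn_ord orbT.
  have -> : (e * M * N = N * (size f).-1)%N by rewrite Ef; lia.
  by rewrite leq_mul2l -ltnS prednK // ltn_ord orbT.
rewrite Wd subr_eq0; apply/eqP => /(congr1 (fun p : {poly L} => p`_(size g).-1)).
rewrite coefC coefZ coefXn eqxx mulr1 Eg eqn0Ngt muln_gt0 e0 N_gt0 /= => /esym/eqP.
by rewrite lead_coef_eq0 -size_poly_eq0 eqn0Ngt g0.
Qed.
End Monomials.

(** With these weights [t] has weight aN - bM = -1 and [u] has weight 0. The shifts [p] and [q]
    clear the denominators of t^i u^l and keep the natural subtractions exact. *)
Lemma weight_chart M N a b p q i l :
    (b * M)%N = (a * N).+1 -> (M * l <= p)%N -> (b * i <= q)%N ->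
  (N * (p + a * i - M * l) + M * (q + N * l - b * i) = N * p + M * q - i
   /\ i <= N * p + M * q)%N.
Proof.
move=> bM_aN hl hi; have E : (M * (b * i) = N * (a * i) + i)%N.
  by rewrite mulnA [(M * b)%N]mulnC bM_aN mulSn addnC mulnA [(a * N)%N]mulnC.
have hl' : (N * (M * l) <= N * p)%N by rewrite leq_mul2l hl orbT.
have hi' : (M * (b * i) <= M * q)%N by rewrite leq_mul2l hi orbT.
have C : (M * (N * l) = N * (M * l))%N by rewrite mulnCA.
rewrite !mulnBr !mulnDr C; move: hl' hi'; rewrite E; lia.
Qed.

(** * Points at infinity as roots of the initial form *)

Section InitialFormRoots.
Variables (L K : fieldType) (j : {rmorphism L -> K}) (x y : K).
Variables (P : {poly {poly L}}) (M N a b : nat).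
Hypotheses (x0 : x != 0) (y0 : y != 0) (N_gt0 : (0 < N)%N).
Hypothesis bM_aN : (b * M)%N = (a * N).+1.
Hypothesis kerP : forall A, evalXY j x y A = 0 <-> divides P A.
Hypothesis P0 : P != 0.
Variable c : L.
Hypothesis c0 : c != 0.

Let t := x ^+ a / y ^+ b.
Let u := y ^+ N / x ^+ M.

(** Rewriting [P] in the chart and multiplying by t^d u^B gives a polynomial [P'] that vanishes on
    the curve. At t = 0 only the terms of top weight [d] survive, and they form the initial form. *)
Lemma point_at_infinity_root :
  point_at_infinity j t u (c ^+ N) -> root (initial_form M N P) c.
Proof.
move=> inf; pose I := sizeY P; pose J := size P.
have [xV yV] := monomial_chart x0 y0 bM_aN; rewrite -/t -/u in xV yV.
have t0 : t != 0 by rewrite mulf_neq0 ?invr_eq0 ?expf_neq0.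
have u0 : u != 0 by rewrite mulf_neq0 ?invr_eq0 ?expf_neq0.
pose d := (size (weigh M N P)).-1; pose B := (b * I + a * J)%N.
have EP : P = monomialsXY I J (fun i l => P`_l`_i) (fun i _ => i) (fun _ l => l).
  exact: monomialsXYE.
have W0 : weigh M N P != 0 by rewrite weigh_eq0.
have Pd i l : P`_l`_i != 0 -> (N * i + M * l <= d)%N.
  rewrite -(@coef_coef_weigh L M N N_gt0); apply: contra_neqT; rewrite -ltnNge => ltd.
  by rewrite [(weigh _ _ _)`_ _]nth_default ?coef0 //
    -(prednK (n := size (weigh M N P))) ?size_poly_gt0.
pose P' := monomialsXY I J (fun i l => P`_l`_i)
  (fun i l => d - (N * i + M * l))%N (fun i l => B - (b * i + a * l))%N.
have /inf : evalXY j t u P' = 0.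
  have <- : t ^+ d * u ^+ B * evalXY j x y P = 0.
    by rewrite (_ : evalXY j x y P = 0) ?mulr0 //; apply/kerP; exists 1; rewrite mul1r.
  rewrite [in RHS]EP /P' !evalXY_monomials mulr_sumr; apply: eq_bigr => l _.
  rewrite mulr_sumr; apply: eq_bigr => i _.
  have [->|Pil] := eqVneq P`_l`_i 0; first by rewrite rmorph0 !mul0r mulr0.
  have le1 := Pd _ _ Pil.
  have le2 : (b * i + a * l <= B)%N.
    by rewrite leq_add // leq_mul2l (ltnW (ltn_ord _)) orbT.
  have -> : t ^+ d = t ^+ (d - (N * i + M * l)) * (t ^+ (N * i) * t ^+ (M * l)).
    by rewrite -!exprD subnK.
  have -> : u ^+ B = u ^+ (B - (b * i + a * l)) * (u ^+ (b * i) * u ^+ (a * l)).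
    by rewrite -!exprD subnK.
  have -> : t ^+ (N * i) = x ^- i / u ^+ (b * i).
    by rewrite -[x ^- i]exprVn xV [(t ^+ N * _) ^+ i]exprMn -!exprM mulfK // expf_neq0.
  have -> : t ^+ (M * l) = y ^- l / u ^+ (a * l).
    by rewrite -[y ^- l]exprVn yV [(t ^+ M * _) ^+ l]exprMn -!exprM mulfK // expf_neq0.
  have xi0 : x ^+ i != 0 by rewrite expf_neq0.
  have yl0 : y ^+ l != 0 by rewrite expf_neq0.
  have ui0 : u ^+ (b * i) != 0 by rewrite expf_neq0.
  have ul0 : u ^+ (a * l) != 0 by rewrite expf_neq0.
  move: (x ^+ i) (y ^+ l) (u ^+ (b * i)) (u ^+ (a * l)) (t ^+ _) (u ^+ _) xi0 yl0 ui0 ul0.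
  by move=> X Y U V T U' X0 Y0 U0 V0; field; rewrite X0 Y0 U0 V0.
rewrite horner2_evalXY evalXY_monomials => sum0.
(* The initial form at [c] times c^(NB) is matched term by term with c^(bd) times the value of [P']
   at (0, c^N). In weight [d] the exponents agree by bM = aN + 1; the other terms carry a positive
   power of 0. *)
rewrite rootE -(mulrI_eq0 _ (mulfI (expf_neq0 (N * B) c0))); apply/eqP.
rewrite -[RHS](mulr0 (c ^+ (b * d))) -[in RHS]sum0.
rewrite /initial_form lead_coefE -/d [in LHS]EP coef_weigh_monomials.
rewrite horner_sum !mulr_sumr; apply: eq_bigr => l _.
rewrite horner_sum !mulr_sumr; apply: eq_bigr => i _ /=.
have [->|Pil] := eqVneq P`_l`_i 0; first by rewrite !mul0r scale0r horner0 !mulr0.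
rewrite hornerZ hornerXn; have := Pd _ _ Pil; rewrite leq_eqVlt => /orP[/eqP Ed|ltd].
  have le2 : (b * i + a * l <= B)%N.
    by rewrite leq_add // leq_mul2l (ltnW (ltn_ord _)) orbT.
  rewrite -Ed eqxx mulr1 subnn expr0 mulr1 mulrCA [RHS]mulrCA; congr (_ * _).
  rewrite -exprM -!exprD; congr (_ ^+ _).
  rewrite mulnBr; have : (N * (b * i + a * l) <= N * B)%N by rewrite leq_mul2l le2 orbT.
  by move: bM_aN; clear; nia.
rewrite gtn_eqF // mulr0 !mul0r mulr0 expr0n subn_eq0 leqNgt ltd.
by rewrite mulr0 !mul0r mulr0.
Qed.

(** If H(t, u) = 0, then x^p y^q H(t, u) is a polynomial [H'] in X and Y divisible by [P], so the
    initial form of [P] divides that of [H']. Were H(0, c^N) nonzero, the latter would not vanish at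
    [c]. *)
Lemma root_point_at_infinity :
  root (initial_form M N P) c -> point_at_infinity j t u (c ^+ N).
Proof.
move=> rc H H0; apply: contraTeq rc => Hw.
pose I := sizeY H; pose J := size H; pose p := (M * J)%N; pose q := (b * I)%N.
have EH : H = monomialsXY I J (fun i l => H`_l`_i) (fun i _ => i) (fun _ l => l).
  exact: monomialsXYE.
pose H' := monomialsXY I J (fun i l => H`_l`_i)
  (fun i l => p + a * i - M * l)%N (fun i l => q + N * l - b * i)%N.
have leM (l : 'I_J) : (M * l <= p)%N by rewrite leq_mul2l (ltnW (ltn_ord _)) orbT.
have leb (i : 'I_I) : (b * i <= q)%N by rewrite leq_mul2l (ltnW (ltn_ord _)) orbT.
have [B EB] : divides P H'.
  apply/kerP; transitivity (x ^+ p * y ^+ q * evalXY j t u H); last by rewrite H0 mulr0.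
  rewrite [in RHS]EH /H' !evalXY_monomials mulr_sumr; apply: eq_bigr => l _.
  rewrite mulr_sumr; apply: eq_bigr => i _.
  have -> : x ^+ (p + a * i - M * l) = x ^+ p * x ^+ (a * i) / x ^+ (M * l).
    by rewrite -exprD -[in RHS](subnK (leq_trans (leM l) (leq_addr (a * i) p)))
      exprD mulfK // expf_neq0.
  have -> : y ^+ (q + N * l - b * i) = y ^+ q * y ^+ (N * l) / y ^+ (b * i).
    by rewrite -exprD -[in RHS](subnK (leq_trans (leb i) (leq_addr (N * l) q)))
      exprD mulfK // expf_neq0.
  rewrite /t /u !exprMn !exprVn -!exprM.
  by field; rewrite !expf_neq0.
pose D := (N * p + M * q)%N.
have wH (l : 'I_J) (i : 'I_I) :
    (N * (p + a * i - M * l) + M * (q + N * l - b * i) = D - i /\ i <= D)%N.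
  exact: weight_chart.
have sW : (size (weigh M N H') <= D.+1)%N.
  apply/leq_sizeP => k ltk; rewrite coef_weigh_monomials big1 // => l _.
  rewrite big1 // => i _; have [-> _] := wH l i.
  by rewrite gtn_eqF ?mulr0 ?scale0r // (leq_ltn_trans (leq_subr _ _)).
(* Weight [D] is attained exactly by the terms of [H] with no factor X, as each X lowers the weight
   by 1. *)
have WD : ((weigh M N H')`_D).[c] = c ^+ q * H.[(c ^+ N)%:P].[0].
  rewrite coef_weigh_monomials horner2_evalXY [in RHS]EH evalXY_monomials.
  rewrite horner_sum mulr_sumr; apply: eq_bigr => l _.
  rewrite horner_sum mulr_sumr; apply: eq_bigr => i _ /=.
  have [-> iD] := wH l i; rewrite hornerZ hornerXn.
  case: i iD => [[|i] /= ltI] iD.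
    by rewrite subn0 eqxx expr0 muln0 subn0 !mulr1 exprD exprM mulrCA.
  by rewrite gtn_eqF ?mulr0 ?mul0r ?expr0n ?mulr0 ?mul0r ?mulr0 //
    ltn_subrL (leq_trans _ iD).
have WD0 : ((weigh M N H')`_D).[c] != 0 by rewrite WD; rewrite mulf_neq0 // expf_neq0.
have : (initial_form M N H').[c] != 0.
  by rewrite (initial_formE sW) //; apply: contra_neq WD0 => ->; rewrite horner0.
rewrite EB initial_formM hornerM mulf_eq0 negb_or => /andP[_].
by rewrite rootE.
Qed.
End InitialFormRoots.

(** * Counting the points at infinity *)

Lemma separable_binomial (F : fieldType) (n : nat) (a b : F) :
  n%:R != 0 :> F -> a != 0 -> b != 0 -> separable_poly (a%:P - b *: 'X^n).
Proof.
move=> n0 a0 b0; rewrite unlock; apply/Bezout_coprimepP.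
(* For p = a - bX^n, the combination p - (X/n)p' is the nonzero constant [a]. *)
exists (1, - n%:R^-1 *: 'X) => /=.
rewrite mul1r derivB derivC derivZ derivXn sub0r.
case: n n0 => [|n] n0; first by rewrite mulr0n eqxx in n0.
rewrite -scaleNr -!mul_polyC /= -(mulr_natl 'X^n) -polyC_natr !polyCN.
rewrite [X in X %= 1](_ : _ = a%:P); first by rewrite polyC_eqp1.
have : (n.+1%:R^-1)%:P * (n.+1%:R)%:P = 1 :> {poly F}.
  by rewrite -polyCM mulVf.
rewrite exprS; move: (n.+1%:R^-1)%:P (n.+1%:R)%:P => i m im.
transitivity (a%:P - b%:P * ('X * 'X^n) + (i * m) * b%:P * ('X * 'X^n)); first by ring.
by rewrite im; ring.
Qed.

Lemma coprime_bezout M N : (0 < M)%N -> coprime M N ->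
  exists a b, (b * M)%N = (a * N).+1.
Proof.
move=> M0 /eqP cMN; case: (egcdnP N M0) => b a E _.
by exists a, b; rewrite E cMN addn1.
Qed.

(** * Factors of the curve equation *)

Section CurveEquation.
Variables (k : fieldType) (f g : {poly k}).
Hypothesis sg : (1 < size g)%N.

Let size_map_g : size (map_poly polyC g) = size g.
Proof. by rewrite size_map_inj_poly //; exact: polyC_inj. Qed.

Lemma size_curve_eqn : size (curve_eqn f g) = size g.
Proof.
rewrite /curve_eqn addrC size_polyDl size_polyN size_map_g //.
exact: leq_ltn_trans (size_polyC_leq1 _) sg.
Qed.

Lemma lead_coef_curve_eqn : lead_coef (curve_eqn f g) = (- lead_coef g)%:P.
Proof.
rewrite /curve_eqn addrC lead_coefDl ?lead_coefN ?lead_coef_map_inj ?polyCN //;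
  try exact: polyC_inj.
by rewrite size_polyN size_map_g (leq_ltn_trans (size_polyC_leq1 _) sg).
Qed.

Lemma curve_eqn_neq0 : curve_eqn f g != 0.
Proof. by rewrite -size_poly_gt0 size_curve_eqn (ltn_trans _ sg). Qed.

(** As a polynomial in Y the equation has leading coefficient in k, so every factor has unit leading
    coefficient. *)
Lemma lead_coef_curve_factor (P : {poly {poly k}}) :
  divides P (curve_eqn f g) -> lead_coef P \is a GRing.unit.
Proof.
case=> Q E; have := lead_coef_curve_eqn; rewrite E lead_coefM => El.
have : lead_coef Q * lead_coef P \is a GRing.unit.
  rewrite El poly_unitE size_polyC coefC /= unitfE oppr_eq0 lead_coef_eq0.
  by rewrite -size_poly_gt0 (ltn_trans _ sg).
by rewrite unitrM => /andP[].
Qed.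

Lemma size_curve_factor (P : {poly {poly k}}) :
  prime_element P -> divides P (curve_eqn f g) -> (1 < size P)%N.
Proof.
move=> [_ nu _] /lead_coef_curve_factor lP; rewrite ltnNge; apply: contra nu.
move=> /size1_polyC EP; rewrite EP lead_coefC in lP.
have p0 : P`_0 != 0 by apply: contraTneq lP => ->; rewrite unitr0.
by rewrite EP poly_unitE size_polyC coefC p0 /= lP.
Qed.
End CurveEquation.

Section CountBranches.
Variables (L K : fieldType) (j : {rmorphism L -> K}) (x y : K).
Variables (P : {poly {poly L}}) (f g : {poly L}) (M N e a b : nat).
Hypothesis char0 : [pchar L] =i pred0.
Hypothesis L_closed : forall p : {poly L},
  exists s : seq L, p = lead_coef p *: \prod_(w <- s) ('X - w%:P).
Hypotheses (x0 : x != 0) (y0 : y != 0) (sf : (1 < size f)%N) (sg : (1 < size g)%N).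
Hypotheses (Ef : (size f).-1 = (e * M)%N) (Eg : (size g).-1 = (e * N)%N).
Hypotheses (M_gt0 : (0 < M)%N) (N_gt0 : (0 < N)%N) (e_gt0 : (0 < e)%N).
Hypothesis bM_aN : (b * M)%N = (a * N).+1.
Hypothesis kerP : forall A, evalXY j x y A = 0 <-> divides P A.
Hypothesis P_fg : divides P (curve_eqn f g).

Let t := x ^+ a / y ^+ b.
Let u := y ^+ N / x ^+ M.
Let lam := initial_form M N P.

Let natr_neq0 n : (0 < n)%N -> n%:R != 0 :> L.
Proof. by move=> n0; rewrite (pcharf0P _).1 // -lt0n. Qed.

Let f0 : lead_coef f != 0.
Proof. by rewrite lead_coef_eq0 -size_poly_gt0 (ltn_trans _ sf). Qed.
Let g0 : lead_coef g != 0.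
Proof. by rewrite lead_coef_eq0 -size_poly_gt0 (ltn_trans _ sg). Qed.

Let P0 : P != 0.
Proof.
case: P_fg => Q E; apply: contraTneq (curve_eqn_neq0 f sg) => P0.
by rewrite E P0 mulr0 eqxx.
Qed.

Let binom := (lead_coef f)%:P - lead_coef g *: 'X^((size g).-1).

Let binom_factor : exists2 l, l != 0 & l * lam = binom.
Proof.
case: P_fg => Q E; exists (initial_form M N Q).
  rewrite initial_form_eq0 //; apply: contraTneq (curve_eqn_neq0 f sg) => Q0.
  by rewrite E Q0 mul0r eqxx.
rewrite /binom -(@initial_form_curve _ M N M_gt0 N_gt0 f g e) //.
by rewrite E initial_formM.
Qed.

(** Passing to initial forms cannot raise the degree in Y of [P] or of its cofactor [Q], and it
    preserves the degree of their product; hence it preserves both. *)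
Let size_lam : size lam = size P.
Proof.
case: (P_fg) => Q E; have Q0 : Q != 0.
  apply: contraTneq (curve_eqn_neq0 f sg) => Q0; by rewrite E Q0 mul0r eqxx.
have sPQ : (size Q + size P).-1 = size g.
  by rewrite -size_mul // -E size_curve_eqn.
have sg0 : (0 < size g)%N by exact: ltn_trans sg.
have sl : (size (initial_form M N Q) + size lam).-1 = size g.
  rewrite -size_mul ?initial_form_eq0 // -initial_formM -E.
  rewrite (@initial_form_curve _ M N M_gt0 N_gt0 f g e) // addrC size_polyDl.
    by rewrite size_polyN size_scale // size_polyXn prednK.
  rewrite size_polyN size_scale // size_polyXn prednK //.
  exact: leq_ltn_trans (size_polyC_leq1 _) sg.
have hQ := @size_initial_form _ M N Q.
have hP := @size_initial_form _ M N P.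
have sP : (0 < size P)%N by rewrite size_poly_gt0.
have sQ : (0 < size Q)%N by rewrite size_poly_gt0.
apply/eqP; rewrite eqn_leq hP /=; move: sPQ sl hQ hP sP sQ sg; rewrite -/lam; clear.
move: (size _) (size _) (size _) (size _) (size _) => p q p' q' n; lia.
Qed.

Let root_lam_branch c : root lam c -> c != 0 /\ branch_value f g e (c ^+ N).
Proof.
case: binom_factor => l _ El rc; have : root binom c by rewrite -El rootM rc orbT.
rewrite rootE /binom hornerD hornerN hornerC hornerZ hornerXn subr_eq0 => /eqP E.
split.
  apply: contraTneq f0 => c0; rewrite E c0 expr0n Eg eqn0Ngt muln_gt0 e_gt0 N_gt0.
  by rewrite mulr0 eqxx.
by rewrite /branch_value -exprM mulnC -Eg E mulrAC mulfV // mul1r.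
Qed.

(** The roots of [lam] are simple, being roots of a separable binomial, so there are as many as the
    degree of [P] in Y. Being a root depends only on the [N]-th power, so c -> c^N maps the roots
    onto [T] with fibres of size [N]. *)
Lemma count_branches : exists T : seq L, [/\ uniq T,
    forall w, w \in T <-> point_at_infinity j t u w /\ branch_value f g e w
  & (size P).-1 = (N * size T)%N].
Proof.
have [rs Ers] := L_closed lam.
have lam0 : lead_coef lam != 0.
  by rewrite lead_coef_eq0 initial_form_eq0.
have rsE c : (c \in rs) = root lam c.
  by rewrite Ers rootZ // root_prod_XsubC.
have rs_uniq : uniq rs.
  rewrite -separable_prod_XsubC; have [l _ El] := binom_factor.
  apply: (@dvdp_separable _ binom); last first.
    by apply: separable_binomial => //; rewrite Eg natr_neq0 // muln_gt0 e_gt0.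
  by rewrite -El Ers dvdp_mull // dvdpZr.
have size_rs : (size P).-1 = size rs.
  by rewrite -size_lam Ers size_scale // size_prod_XsubC.
exists (undup [seq c ^+ N | c <- rs]); split.
- exact: undup_uniq.
- move=> w; rewrite mem_undup; split=> [/mapP[c]|[iw vw]].
    rewrite rsE => rc ->; have [c0 vc] := root_lam_branch rc.
    split=> //; exact: (root_point_at_infinity x0 y0 bM_aN kerP c0 rc).
  have w0 : w != 0.
    apply: contra_eq_neq vw => ->.
    rewrite expr0n eqn0Ngt e_gt0 /= eq_sym mulf_neq0 ?invr_eq0 //.
  have [s Es] := L_closed ('X^N - w%:P).
  have mw : 'X^N - w%:P \is monic by apply: monicXnsubC.
  case: s Es => [|c s] Es.
    have := congr1 (fun p : {poly L} => size p) Es.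
    by rewrite big_nil (monicP mw) scale1r size_poly1 size_XnsubC //; case: (N) N_gt0.
  have /eqP Ec : c ^+ N == w.
    have : root ('X^N - w%:P) c.
      by rewrite Es (monicP mw) scale1r root_prod_XsubC mem_head.
    by rewrite rootE hornerD hornerN hornerXn hornerC subr_eq0.
  apply/mapP; exists c => //; rewrite rsE.
  apply: (point_at_infinity_root x0 y0 N_gt0 bM_aN kerP P0).
    by apply: contraTneq w0 => c0; rewrite -Ec c0 expr0n eqn0Ngt N_gt0 eqxx.
  by rewrite Ec.
rewrite size_rs; set T := undup _.
have Tmem c : c \in rs -> c ^+ N \in T.
  by move=> rc; rewrite mem_undup; apply: map_f.
(* All [N] distinct [N]-th roots of [w] are roots of [lam]: go from one root to the point [w], and
   from that point back to every other root. *)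
have fib w : w \in T -> count (fun c => c ^+ N == w) rs = N.
  rewrite mem_undup => /mapP[c rc Ew].
  have [c0 _] : c != 0 /\ branch_value f g e (c ^+ N).
    by apply: root_lam_branch; rewrite -rsE.
  have iw : point_at_infinity j t u w.
    rewrite rsE in rc.
    by rewrite Ew; exact: (root_point_at_infinity x0 y0 bM_aN kerP c0 rc).
  have w0 : w != 0 by rewrite Ew expf_neq0.
  have [s Es] := L_closed ('X^N - w%:P).
  have mw : 'X^N - w%:P \is monic by apply: monicXnsubC.
  rewrite (monicP mw) scale1r in Es.
  have us : uniq s.
    rewrite -separable_prod_XsubC -Es.
    have -> : 'X^N - w%:P = (- w)%:P - (-1) *: 'X^N.
      by rewrite scaleN1r opprK polyCN addrC.
    by apply: separable_binomial; rewrite ?oppr_eq0 ?oner_neq0 // natr_neq0.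
  have ss : size s = N.
    have := congr1 (fun p : {poly L} => size p) Es.
    by rewrite size_XnsubC // size_prod_XsubC => -[].
  rewrite -size_filter; apply: etrans ss; apply: perm_size; apply: uniq_perm => //.
    exact: filter_uniq.
  move=> d; rewrite mem_filter /=.
  have -> : (d \in s) = (d ^+ N == w).
    by rewrite -root_prod_XsubC -Es rootE hornerD hornerN hornerXn hornerC subr_eq0.
  apply: andb_idr => /eqP Ed; rewrite rsE.
  apply: (point_at_infinity_root x0 y0 N_gt0 bM_aN kerP P0); last by rewrite Ed.
  by apply: contraTneq w0 => d0; rewrite -Ed d0 expr0n eqn0Ngt N_gt0 eqxx.
have -> : size rs = (\sum_(w <- T) count (fun c => c ^+ N == w) rs)%N.
  under eq_bigr => w _ do rewrite -sum1_count big_mkcond.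
  rewrite exchange_big /= -sum1_size big_seq [RHS]big_seq.
  apply: eq_bigr => c rc; rewrite -big_mkcond sum1_count /=.
  rewrite (eq_count (a2 := pred1 (c ^+ N))) => [|w]; last by rewrite /= eq_sym.
  by rewrite count_uniq_mem ?undup_uniq // Tmem.
rewrite big_seq (eq_bigr (fun=> N)) => [|w wT]; last exact: fib.
by rewrite -big_seq big_const_seq count_predT iter_addn_0.
Qed.
End CountBranches.

(** * Counting the places where a coordinate has a pole *)

Section PlacesAtInfinity.
Variables (L K : fieldType) (phi : {rmorphism {poly {poly L}} -> K}).
Variables (P : {poly {poly L}}) (f g : {poly L}).
Hypothesis char0 : [pchar L] =i pred0.
Hypothesis L_closed : forall p : {poly L},
  exists s : seq L, p = lead_coef p *: \prod_(w <- s) ('X - w%:P).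
Hypothesis phiP : function_field_of phi P.
Hypothesis P_prime : prime_element P.
Hypotheses (sf : (1 < size f)%N) (sg : (1 < size g)%N).
Hypothesis P_fg : divides P (curve_eqn f g).

Let j := const_morph phi.
Let x := phi 'X%:P.
Let y := phi 'X.

Let fg : eval_poly j x f = eval_poly j y g.
Proof.
have /phiP.1/eqP := P_fg.
rewrite rmorphB subr_eq0 => /eqP; rewrite rmorph_polyCE => ->.
by rewrite rmorph_evalXY evalXY_map_polyC.
Qed.

(** By f(x) = g(y), each coordinate is integral over the ring generated by the other. *)
Lemma infinite_place_coordinates O :
  valuation_ring j O -> (O x <-> O y).
Proof.
move=> Ov; split=> Oz; apply: (valuation_eval_poly Ov).
- exact: sg.
- rewrite -fg; exact: (subalgebra_eval_poly (valuation_subalgebra Ov)).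
- exact: sf.
by rewrite fg; exact: (subalgebra_eval_poly (valuation_subalgebra Ov)).
Qed.

Lemma count_infinite_places :
  (size P).-1 = ((size g).-1 %/ gcdn (size f).-1 (size g).-1 *
    #|` fset_set [set O | valuation_ring j O /\ ~ O x]|)%N.
Proof.
have sP := size_curve_factor sg P_prime P_fg.
have x0 : x != 0 by rewrite (function_field_polyC_eq0 phiP sP) polyX_eq0.
(* If y = 0, then f(x) is a constant, although x satisfies no nontrivial polynomial relation over
   L. *)
have y0 : y != 0.
  apply: contraTneq sf => y0; rewrite -leqNgt.
  have [c Ec] : exists c, eval_poly j y g = j c.
    elim/poly_ind: (g) => [|p c _]; first by exists 0; rewrite !rmorph0.
    exists c; rewrite rmorphD rmorphM /= eval_polyX eval_polyC.
    by rewrite y0 mulr0 add0r.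
  have /eqP : f - c%:P == 0.
    rewrite -(function_field_polyC_eq0 phiP sP) polyCB rmorphB rmorph_polyCE.
    by rewrite -/j -/x fg Ec subrr.
  by move/eqP; rewrite subr_eq0 => /eqP->; exact: size_polyC_leq1.
set m := (size f).-1; set n := (size g).-1.
have m_gt0 : (0 < m)%N by rewrite /m -ltnS prednK // (ltn_trans _ sf).
have n_gt0 : (0 < n)%N by rewrite /n -ltnS prednK // (ltn_trans _ sg).
set e := gcdn m n; have e_gt0 : (0 < e)%N by rewrite gcdn_gt0 m_gt0.
pose M := (m %/ e)%N; set N := (n %/ e)%N.
have Em : m = (e * M)%N by rewrite mulnC divnK ?dvdn_gcdl.
have En : n = (e * N)%N by rewrite mulnC divnK ?dvdn_gcdr.
have M_gt0 : (0 < M)%N by move: m_gt0; rewrite Em muln_gt0 => /andP[].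
have N_gt0 : (0 < N)%N by move: n_gt0; rewrite En muln_gt0 => /andP[].
have cMN : coprime M N.
  by rewrite /coprime -(eqn_pmul2l e_gt0) muln1 muln_gcdr -Em -En.
have [a [b bM_aN]] := coprime_bezout M_gt0 cMN.
have kerP A : evalXY j x y A = 0 <-> divides P A.
  by rewrite -rmorph_evalXY; exact: phiP.1.
have [T [uT HT ->]] := count_branches char0 L_closed x0 y0 sf sg Em En
  M_gt0 N_gt0 e_gt0 bM_aN kerP P_fg.
have [xV yV] := monomial_chart x0 y0 bM_aN.
set t := x ^+ a / y ^+ b in HT xV yV; set u := y ^+ N / x ^+ M in HT xV yV.
have t0 : t != 0 by rewrite mulf_neq0 ?invr_eq0 ?expf_neq0.
have ue : u ^+ e = y ^+ n / x ^+ m.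
  by rewrite Em En /u exprMn exprVn -!exprM ![(e * _)%N]mulnC.
have e0 : e%:R != 0 :> L by rewrite (pcharf0P _).1 // -lt0n.
have gen z : exists U r, r != 0 /\ z = evalXY j x y U / eval_poly j x r.
  have [U [r [r0 ->]]] := function_field_denominator phiP P_prime sP z.
  by exists U, r; rewrite -rmorph_evalXY -rmorph_polyCE.
rewrite (infinite_placesE sf sg fg x0 y0 t0 xV yV ue M_gt0 N_gt0 e0 L_closed gen).
have -> : [set w | point_at_infinity j t u w /\ branch_value f g e w] =
    [set` [fset w in T]%fset].
  by apply/seteqP; split=> w /=; rewrite inE /= => /HT.
congr (_ * _)%N; rewrite fset_set_image // set_fsetK card_in_imfset /=.
  by rewrite card_fseq undup_id.
move=> w w'; rewrite !inE /= => /HT[iw vw] /HT[iw' vw'].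
exact: (branch_ring_inj sf sg fg x0 y0 t0 xV yV ue M_gt0 N_gt0 e0 iw vw iw' vw').
Qed.
End PlacesAtInfinity.

(** * Plane curves *)

Lemma fraction_quotient (R : idomainType) (z : {fraction R}) :
  exists n d : R, tofrac d != 0 /\ z = tofrac n / tofrac d.
Proof.
elim/quotW: z => q; exists q.1, q.2.
have d0 : tofrac q.2 != 0 by rewrite tofrac_eq0 denom_ratioP.
split=> //; apply: (mulIf d0); rewrite mulfVK //; unlock tofrac.
rewrite -[LHS]FracField.pi_mul; apply/eqmodP.
rewrite /= FracField.equivfE /FracField.mulf.
by rewrite !numden_Ratio ?mulf_neq0 ?denom_ratioP ?oner_neq0 // !mulr1 mulrC.
Qed.

Section CoordinateMorphism.
Variables (k : fieldType) (C : plane_curve k).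

Definition coord_morph : {rmorphism {poly {poly k}} -> function_field C} :=
  [the {rmorphism coordinate_ring C -> function_field C} of @tofrac (coordinate_ring C)]
  \o prime_class (curve_prime_ideal C).

Lemma prime_class_surj (v : coordinate_ring C) :
  exists A, v = prime_class (curve_prime_ideal C) A.
Proof. by elim/quotW: v => A; exists A. Qed.

Lemma prime_class_eq0 A :
  (prime_class (curve_prime_ideal C) A == 0) = (A \in curve_prime_ideal C).
Proof.
rewrite -(rmorph0 (prime_class (curve_prime_ideal C))) -[A in RHS]subr0.
by rewrite Quotient.idealrBE.
Qed.

Lemma coord_morphP : function_field_of coord_morph (equation C).
Proof.
split=> [A|z].
  split=> [/eqP|/asboolP PA]; last apply/eqP; rewrite /= tofrac_eq0 prime_class_eq0.
    by move/asboolP.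
  exact: PA.
have [n [d [d0 ->]]] := fraction_quotient z.
have [A EA] := prime_class_surj n; have [B EB] := prime_class_surj d.
by exists A, B; rewrite /= -EA -EB.
Qed.

Lemma horner_const_fun (p : {poly k}) :
  (map_poly (const_fun C) p).[fun_X C] = coord_morph p%:P.
Proof. by rewrite rmorph_polyCE. Qed.

Lemma horner_const_funY (p : {poly k}) :
  (map_poly (const_fun C) p).[fun_Y C] = coord_morph (map_poly polyC p).
Proof. by rewrite rmorph_evalXY evalXY_map_polyC. Qed.

(** If x lies in [O], so does y, hence the coordinate ring and, as [O] is integrally closed, the
    whole normalization. Conversely x belongs to the normalization. *)
Lemma boundaryE (f g : {poly k}) :
    (1 < size f)%N -> (1 < size g)%N -> divides (equation C) (curve_eqn f g) ->
  @boundary _ C =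
  [set O | valuation_ring (const_morph coord_morph) O /\ ~ O (fun_X C)].
Proof.
move=> sf sg P_fg; rewrite eqEsubset; split=> O /= [Ov nO]; split=> //; last first.
  move=> /(_ (fun_X C)) nO'; apply: nO; apply: nO'.
  pose v := prime_class (curve_prime_ideal C) 'X%:P : coordinate_ring C.
  exists ('X - v%:P); first exact: monicXsubC.
  by rewrite rmorphB /= map_polyX map_polyC /= root_XsubC.
move=> Ox; apply: nO => z [p mp rz].
have {}Ov : valuation_ring (const_morph coord_morph) O by exact: Ov.
have Oy : O (fun_Y C) by apply/(infinite_place_coordinates coord_morphP sf sg P_fg Ov).
apply: (valuation_integrally_closed Ov (monic_map _ mp) _ rz) => i.
rewrite coef_map /=; have [A ->] := prime_class_surj p`_i.
have -> : tofrac (prime_class (curve_prime_ideal C) A) = coord_morph A by [].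
rewrite rmorph_evalXY; exact: (subalgebra_evalXY (valuation_subalgebra Ov)).
Qed.
End CoordinateMorphism.

(** * Exchanging the two coordinates *)

Section Swap.
Variables (k : fieldType).

Lemma divides_swapXY (A B : {poly {poly k}}) :
  divides (swapXY A) (swapXY B) <-> divides A B.
Proof.
split=> -[D E]; exists (swapXY D).
  by rewrite -[B]swapXYK E rmorphM /= swapXYK.
by rewrite E rmorphM.
Qed.

Lemma prime_element_swapXY (P : {poly {poly k}}) :
  prime_element P -> prime_element (swapXY P).
Proof.
case=> P0 nu Pp; split.
- by rewrite swapXY_eq0.
- apply: contra nu => /unitrP[Q [EQ _]]; apply/unitrP; exists (swapXY Q).
  have E : swapXY Q * P = 1 by rewrite -[P]swapXYK -rmorphM EQ rmorph1.
  by rewrite [P * _]mulrC.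
move=> A B; rewrite -[A]swapXYK -[B]swapXYK -rmorphM !divides_swapXY.
exact: Pp.
Qed.

Lemma swap_curve_eqn (f g : {poly k}) P :
  divides P (curve_eqn f g) -> divides (swapXY P) (curve_eqn g f).
Proof.
case=> Q E; exists (- swapXY Q); rewrite mulNr -rmorphM -E /curve_eqn.
by rewrite rmorphB /= swapXY_polyC swapXY_map_polyC opprB.
Qed.

(** The field is unchanged, so the places of the swapped curve are literally the same sets. *)
Lemma function_field_swapXY (K : fieldType) (phi : {rmorphism {poly {poly k}} -> K}) P :
  function_field_of phi P -> function_field_of (phi \o @swapXY k) (swapXY P).
Proof.
case=> kerP fracP; split=> [A|z].
  by rewrite /= kerP -{2}[A]swapXYK divides_swapXY.
have [A [B [B0 ->]]] := fracP z.
by exists (swapXY A), (swapXY B); rewrite /= !swapXYK.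
Qed.
End Swap.

(** * Coordinate degrees and boundary of a plane curve *)

Section Degrees.
Variables (k : fieldType) (C : plane_curve k) (f g : {poly k}).
Hypotheses (sf : (1 < size f)%N) (sg : (1 < size g)%N).
Hypothesis P_fg : divides (equation C) (curve_eqn f g).
Let P := equation C.
Let P_prime : prime_element P := equation_prime C.

Lemma map_degree_X : map_degree (fun_X C) = (size P).-1.
Proof.
rewrite -(function_field_degree (coord_morphP C) P_prime
  (size_curve_factor sg P_prime P_fg) (lead_coef_curve_factor sg P_fg)).
congr (qdim _ _ _); apply/seteqP; split=> z [p [q H]]; exists p, q; move: H;
  by rewrite !horner_const_fun.
Qed.

Lemma map_degree_Y : map_degree (fun_Y C) = (size (swapXY P)).-1.
Proof.
have sP_fg := swap_curve_eqn P_fg; have sP_prime := prime_element_swapXY P_prime.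
rewrite -(function_field_degree (function_field_swapXY (coord_morphP C)) sP_prime
  (size_curve_factor sf sP_prime sP_fg) (lead_coef_curve_factor sf sP_fg)).
congr (qdim _ _ _); apply/seteqP; split=> z [p [q H]]; exists p, q; move: H;
  by rewrite !horner_const_funY /= !swapXY_polyC.
Qed.

Hypothesis char0 : [pchar k] =i pred0.
Hypothesis k_closed : forall p : {poly k},
  exists s : seq k, p = lead_coef p *: \prod_(w <- s) ('X - w%:P).
Let m := (size f).-1.
Let n := (size g).-1.

Lemma count_boundary_X :
  (size P).-1 = (n %/ gcdn m n * #|` fset_set (@boundary _ C)|)%N.
Proof.
rewrite (boundaryE sf sg P_fg).
exact: (count_infinite_places char0 k_closed (coord_morphP C) P_prime sf sg P_fg).
Qed.

Lemma count_boundary_Y :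
  (size (swapXY P)).-1 = (m %/ gcdn m n * #|` fset_set (@boundary _ C)|)%N.
Proof.
rewrite (boundaryE sf sg P_fg) gcdnC.
rewrite (count_infinite_places char0 k_closed (function_field_swapXY (coord_morphP C))
  (prime_element_swapXY P_prime) sg sf (swap_curve_eqn P_fg)).
congr (_ * #|` fset_set _|)%N.
have jE : (const_morph (coord_morph C \o @swapXY k) : k -> function_field C) =
          const_morph (coord_morph C).
  by apply/funext => c; rewrite /= swapXY_polyC map_polyC.
have yE : coord_morph C (swapXY 'X%:P) = fun_Y C.
  by rewrite swapXY_polyC map_polyX.
(* The swapped count concerns poles of y; these occur at the same places as poles of x. *)
rewrite jE; apply/seteqP; split=> O [Ov nO]; split=> // Oz; apply: nO;
  have [xy yx] := infinite_place_coordinates (coord_morphP C) sf sg P_fg Ov.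
  by have := xy Oz; rewrite -[coord_morph C 'X]yE; apply.
by apply: yx; rewrite -[coord_morph C 'X]yE; exact: Oz.
Qed.
End Degrees.

(** With a unit leading coefficient, [P] is a unit times Y - h; substituting Y = h in the curve
    equation gives f = g o h. *)
Lemma graph_of_degree1 (k : fieldType) (P : {poly {poly k}}) (f g : {poly k}) :
    (1 < size g)%N -> divides P (curve_eqn f g) -> size P = 2%N ->
  exists h : {poly k}, f = g \Po h /\
    forall A, divides P A <-> divides ('X - h%:P) A.
Proof.
move=> sg P_fg sP; have lP := lead_coef_curve_factor sg P_fg.
set c := lead_coef P in lP; pose h := - c^-1 * P`_0.
have EP : P = c%:P * ('X - h%:P).
  apply/polyP => i; rewrite coefCM coefB coefX coefC /h.
  case: i => [|[|i]] /=.
  - by rewrite sub0r mulNr opprK mulVKr.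
  - by rewrite subr0 mulr1 /c lead_coefE sP.
  by rewrite subrr mulr0 nth_default // sP.
have divE A : divides P A <-> divides ('X - h%:P) A.
  split=> -[Q ->]; first by exists (Q * c%:P); rewrite EP mulrA.
  by exists (Q * c^-1%:P); rewrite EP mulrA -(mulrA Q) -polyCM mulVr // polyC1 mulr1.
exists h; split=> //; have /divE[Q E] := P_fg.
have := congr1 (fun A : {poly {poly k}} => A.[h]) E.
rewrite /curve_eqn hornerM hornerXsubC subrr mulr0 hornerD hornerN hornerC.
by move/eqP; rewrite subr_eq0 => /eqP.
Qed.

(** * Passage to the algebraic closure *)

Section BaseChange.
Variables (k kbar : fieldType) (iota : {rmorphism k -> kbar}).

Lemma map_curve_eqn (f g : {poly k}) :
  map_poly (map_poly iota) (curve_eqn f g) =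
  curve_eqn (map_poly iota f) (map_poly iota g).
Proof.
rewrite /curve_eqn rmorphB /= map_polyC /= -!map_poly_comp; congr (_ - _).
by apply: eq_map_poly => c /=; rewrite map_polyC.
Qed.

Lemma divides_map (A B : {poly {poly k}}) : divides A B ->
  divides (map_poly (map_poly iota) A) (map_poly (map_poly iota) B).
Proof. by case=> Q ->; exists (map_poly (map_poly iota) Q); rewrite rmorphM. Qed.

Lemma size_map_map_poly (A : {poly {poly k}}) :
  size (map_poly (map_poly iota) A) = size A.
Proof. by rewrite size_map_inj_poly ?rmorph0 //; exact: map_poly_inj. Qed.
End BaseChange.

Section GeomIntegralComponent.
Variables (k : fieldType) (kbar : closedFieldType) (iota : {rmorphism k -> kbar}).
Hypothesis char0 : [pchar k] =i pred0.
Variables f g : {poly k}.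
Hypotheses (sf : (1 < size f)%N) (sg : (1 < size g)%N).
Let m := (size f).-1.
Let n := (size g).-1.
Variable C : geom_integral_curve iota.
Hypothesis C_fg : component_of C f g.

Let char0_bar : [pchar kbar] =i pred0.
Proof. by move=> p; rewrite (fmorph_pchar iota); exact: char0. Qed.

Let bar_closed (p : {poly kbar}) :
  exists s : seq kbar, p = lead_coef p *: \prod_(w <- s) ('X - w%:P).
Proof. by have [s Es] := closed_field_poly_normal p; exists s. Qed.

Let sfbar : (1 < size (map_poly iota f))%N. Proof. by rewrite size_map_poly. Qed.
Let sgbar : (1 < size (map_poly iota g))%N. Proof. by rewrite size_map_poly. Qed.

Let bar_fg : divides (equation (base_change C))
  (curve_eqn (map_poly iota f) (map_poly iota g)).
Proof. by rewrite -map_curve_eqn; exact: divides_map. Qed.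

(** [d_X] and [d_Y] are the degrees of the equation in Y and X, which base change preserves, so the
    count of boundary points over [kbar] computes them. *)
Lemma degrees_of_component :
  d_X C = (n %/ gcdn m n * nb_boundary C)%N /\
  d_Y C = (m %/ gcdn m n * nb_boundary C)%N.
Proof.
rewrite /d_X /d_Y (map_degree_X sg C_fg) (map_degree_Y sf C_fg).
have := count_boundary_X sfbar sgbar bar_fg char0_bar bar_closed.
have := count_boundary_Y sfbar sgbar bar_fg char0_bar bar_closed.
by rewrite /= swapXY_map !size_map_map_poly !size_map_poly.
Qed.

(** The equation has positive degree in Y, so [d_X] is nonzero, which an empty boundary would
    contradict. *)
Lemma nb_boundary_gt0 : (0 < nb_boundary C)%N.
Proof.
rewrite lt0n; apply/eqP => nb0; have [] := degrees_of_component.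
rewrite nb0 muln0 /d_X (map_degree_X sg C_fg) => sP _.
have := size_curve_factor sg (equation_prime C) C_fg.
by case: (size _) sP => [|[]].
Qed.

Lemma log_negative_nb_boundary : log_negative C -> nb_boundary C = 1%N.
Proof.
have := nb_boundary_gt0; rewrite /log_negative /log_degree.
by move: (nb_boundary C) (genus C) => b g'; lia.
Qed.

Lemma nongraph_degree_X : ~ graph_component C f g -> d_X C <> 1%N.
Proof.
move=> nG; rewrite /d_X (map_degree_X sg C_fg) => sP; apply: nG.
apply: graph_of_degree1 => //; have := size_curve_factor sg (equation_prime C) C_fg.
by case: (size _) sP => [|[|[]]].
Qed.
End GeomIntegralComponent.

Lemma divn_gcdr_gt0 m n : (0 < n)%N -> (0 < n %/ gcdn m n)%N.
Proof.
by move=> n0; rewrite divn_gt0 ?gcdn_gt0 ?n0 ?orbT // dvdn_leq // dvdn_gcdr.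
Qed.

Local Open Scope nat_scope.

Theorem corollary2p9 (k : fieldType) (char0 : [pchar k]%R =i pred0)
    (kbar : closedFieldType) (iota : {rmorphism k -> kbar})
    (kbar_algebraic : forall z : kbar, algebraicOver iota z)
    (f g : {poly k}) (f_nonconst : 1 < size f) (g_nonconst : 1 < size g) :
  let m := (size f).-1 in
  let n := (size g).-1 in
  let e := gcdn m n in
  let M := m %/ e in
  let N := n %/ e in
  let nongraph_log_negative_degrees : set nat :=
    [set d | exists C : geom_integral_curve iota,
       [/\ component_of C f g, log_negative C, ~ graph_component C f g
         & d = d_X C]] in
  [/\ forall C : geom_integral_curve iota, component_of C f g ->
        d_X C = N * nb_boundary C /\ d_Y C = M * nb_boundary C,
      forall C : geom_integral_curve iota, component_of C f g ->
        log_negative C -> d_X C = N /\ d_Y C = M,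
      forall C : geom_integral_curve iota, component_of C f g ->
        log_negative C -> ~ graph_component C f g -> 2 <= N
    & (2 <= N -> nongraph_log_negative_degrees = set0 \/
                 nongraph_log_negative_degrees = [set N]) /\
      (N = 1 -> nongraph_log_negative_degrees = set0)].
Proof.
move=> m n e M N D.
have main (C : geom_integral_curve iota) : component_of C f g ->
    d_X C = N * nb_boundary C /\ d_Y C = M * nb_boundary C.
  exact: degrees_of_component.
have log1 (C : geom_integral_curve iota) : component_of C f g ->
    log_negative C -> d_X C = N /\ d_Y C = M.
  move=> C_fg lC; have := main C C_fg.
  by rewrite (log_negative_nb_boundary char0 f_nonconst g_nonconst C_fg lC) !muln1.
have N_gt0 : 0 < N.
  apply: divn_gcdr_gt0; rewrite -ltnS prednK //; exact: ltn_trans g_nonconst.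
have nongraph (C : geom_integral_curve iota) : component_of C f g ->
    log_negative C -> ~ graph_component C f g -> 2 <= N.
  (* A non-graph component has [d_X] different from 1, and here [d_X] equals the positive number
     [N]. *)
  move=> C_fg lC nG; have := nongraph_degree_X g_nonconst C_fg nG.
  by rewrite (log1 C C_fg lC).1; move: N_gt0; move: (N) => [|[]].
split=> //; split=> [_|N1].
  case: (pselect (exists d, D d)) => [[d Dd]|noD]; [right|left]; last first.
    by apply/seteqP; split=> // d Dd; apply: noD; exists d.
  have DN d' : D d' -> d' = N.
    by move=> [C [C_fg lC _ ->]]; exact: (log1 C C_fg lC).1.
  by apply/seteqP; split=> d' /=; [exact: DN|move=> ->; rewrite -(DN d Dd)].
apply/seteqP; split=> // d [C [C_fg lC nG _]].
by have := nongraph C C_fg lC nG; rewrite N1.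
Qed.
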